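(* Consider the Fast-Slow (FS) scenario of the parallel-server system with cancel-on-completion redundancy described in the context: $N\ge 2$ servers, $M=N$ job types, and a type-$j$ job has service speed $r_{jj}=r_{\mathrm{fast}}>0$ on server $j$ and $r_{ij}=r_{\mathrm{slow}}>0$ on every server $i\ne j$. Suppose that job types are unknown and that the i.i.d. speed variations have New-Better-than-Used distributions $S_1,\dots,S_N$. Then, as the ratio $x=r_{\mathrm{slow}}/r_{\mathrm{fast}}\downarrow 0$, the stability region for $d=N$ is larger than the stability region for $d<N$; that is, for every $1\le d<N$ there is $x_0>0$ such that for all $0<x<x_0$ the stability region for $d=N$ strictly contains the stability region for $d$ replicas, with static probabilistic assignment (which cannot depend on the job type).
   Context: **System.** There are $N$ parallel servers, each with its own queue and a first-come-first-served (FCFS) discipline. Jobs arrive as a Poisson process of rate $\lambda$. Each job is independently of type $j\in\{1,\dots,M\}$ with probability $p_j>0$, $\sum_j p_j=1$. A type-$j$ job has a random intrinsic size distributed as $X_j$, and on server $i$ it has service speed $r_{ij}$ and random speed variation $Y_{ij}$, where $Y_{1j},\dots,Y_{Nj}$ are i.i.d. copies of a generic nonnegative random variable $S_j$. The processing time of a replica of the job at server $i$ is $X_jY_{ij}/r_{ij}$. The intrinsic size is independent of the speed variations, and the sizes and speed variations of different jobs are independent of each other and of the arrivals. The means $\mathbb{E}[X_j]$ and $\mathbb{E}[S_j]$ are finite and positive. In the limit $x\downarrow0$ the quantities $N$, $p_j$, $r_{\mathrm{fast}}$ and the laws of $X_j$, $S_j$ are fixed. **Redundancy, cancel-on-completion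 (c.o.c.).** Upon arrival, a job is immediately replicated to $d$ distinct servers and a replica joins the FCFS queue of each of these servers. As soon as the first replica of the job completes service, all its remaining replicas are abandoned (removed from queue or service). For $d=1$ there is no replication. **Static probabilistic assignment, unknown job types.** The dispatcher cannot observe job types. A static policy with $d$ replicas is given by probabilities $q(I)\ge 0$ for each set $I$ of $d$ servers, with $\sum_I q(I)=1$, common to all job types; each arriving job is assigned to $I$ with probability $q(I)$, independently of everything else. **Stability.** Stability of the system under a given policy is meant in the usual queueing sense (positive recurrence/existence of a stationary regime); in a stable system the long-term fraction of time that each server is busy exists and is strictly less than $1$. The stability region for $d$ replicas is the set of all $\lambda\ge 0$ for which there exists a static probabilistic assignment policy with $d$ replicas under which the system is stable. For $d=N$ (where the system behaves as an $M/G/1$ queue) it equals $[0,\lambda^* )$ with $\lambda^*=\big(\sum_{j=1}^M p_j\,\mathbb{E}[X_j]\,\mathbb{E}[\min\{Y_{1j}/r_{1j},\dots,Y_{Nj}/r_{Nj}\}]\big)^{-1}$. **NBU.** Let $S$ be a nonnegative random variable with support $\mathcal{R}_S$ and $\bar F_S(x)=\mathbb{P}(S>x)$. $S$ is New-Better-than-Used (NBU) if $\bar F_S(t_1+t_2)\le\bar F_S(t_1)\bar F_S(t_2)$ for all $t_1,t_2\in\mathcal{R}_S$. *)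

(* Defs.v *)
From HB Require Import structures.
From mathcomp Require Import all_boot all_order all_algebra.
From mathcomp Require Import all_classical all_reals all_analysis.

Set Implicit Arguments.
Unset Strict Implicit.
Unset Printing Implicit Defensive.

Import Order.TTheory GRing.Theory Num.Theory.
Import numFieldNormedType.Exports.

Local Open Scope classical_set_scope.
Local Open Scope ring_scope.

Section random_variables.
Context {R : realType} {dT : measure_display} {T : measurableType dT}.
Variable P : probability T R.

Definition mutually_independent (K : finType) (Z : K -> {RV P >-> R}) : Prop :=
  forall (J : {set K}) (A : K -> set R), (forall k, measurable (A k)) ->
    P (\bigcap_(k in [set k | k \in J]) (Z k @^-1` A k)) =
    (\prod_(k in J) P (Z k @^-1` A k))%E.

(* Closed support of the law of S. *)
Definition rv_support (S : {RV P >-> R}) : set R :=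
  [set t | forall e : R, 0 < e -> (0 < distribution P S (ball t e))%E].

Definition NBU (S : {RV P >-> R}) : Prop :=
  forall t1 t2 : R, rv_support S t1 -> rv_support S t2 ->
    (ccdf S (t1 + t2) <= ccdf S t1 * ccdf S t2)%E.

End random_variables.

Section system.
Context {R : realType} (N M : nat).

(* The workload w_i of server i is the time server i still needs before it has
   no replica left of the jobs present. Under FCFS with cancel-on-completion it
   does not depend on future arrivals. A job joining the servers of I, whose
   replica has processing time b_i at server i, would finish at server i after
   w_i + b_i, hence completes after the smallest of these times. *)
Definition completion_time (w b : 'I_N -> R) (I : {set 'I_N}) : R :=
  inf [set w i + b i | i in [set i | i \in I]].

(* At completion all replicas are removed: a server i of I with w_i at most the
   completion time has been serving its replica since w_i and becomes free, and
   a server with larger w_i loses a replica that was still waiting. *)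
Definition workload_after (w b : 'I_N -> R) (I : {set 'I_N}) (i : 'I_N) : R :=
  if i \in I then Num.max (w i) (completion_time w b I) else w i.

(* Workloads just before the next arrival, tau time units later. *)
Definition next_workload (w : N.-tuple R) (b : 'I_N -> R) (I : {set 'I_N})
    (tau : R) : N.-tuple R :=
  [tuple Num.max 0 (workload_after (tnth w) b I i - tau) | i < N].

(* q I is the probability that a job, whatever its type, is assigned to I. *)
Definition static_policy (d : nat) (q : {set 'I_N} -> R) : Prop :=
  (forall I : {set 'I_N}, #|I| = d -> 0 <= q I) /\
  \sum_(I : {set 'I_N} | #|I| == d) q I = 1.

Context {dT : measure_display} {T : measurableType dT} (P : probability T R).

(* Generic job of each type j: intrinsic size X j, and speed variation Y i j on
   server i, where it has service speed r i j; p is the law of the type. *)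
Variables (X : 'I_M -> {RV P >-> R}) (Y : 'I_N -> 'I_M -> {RV P >-> R}).
Variables (p : 'I_M -> R) (r : 'I_N -> 'I_M -> R).

Definition processing_time (j : 'I_M) (i : 'I_N) (u : T) : R :=
  X j u * Y i j u / r i j.

(* Transition probability of the Markov chain of the workloads seen by
   successive arrivals: type, replica locations, processing times and (by the
   Poisson assumption, exponential) interarrival time are drawn afresh. *)
Definition workload_transition (lambda : R) (d : nat) (q : {set 'I_N} -> R)
    (w : N.-tuple R) (A : set (N.-tuple R)) : \bar R :=
  (\sum_(j < M) \sum_(I : {set 'I_N} | #|I| == d) (p j * q I)%:E *
    \int[P]_u exponential_prob lambda
      [set tau | A (next_workload w (fun i => processing_time j i u) I tau)])%E.

(* Existence of a stationary regime: an invariant probability of the workload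
   chain (it is carried by nonnegative vectors, as next_workload is). From every
   state the exponential interarrival time lets the chain reach the empty state
   in one step with positive probability, so this is positive recurrence.
   With lambda = 0 there are no jobs at all and the system stays empty. *)
Definition stable (lambda : R) (d : nat) (q : {set 'I_N} -> R) : Prop :=
  lambda = 0 \/
  0 < lambda /\
  exists pi : probability (N.-tuple R) R,
    forall A : set (N.-tuple R), measurable A ->
      pi A = (\int[pi]_w workload_transition lambda d q w A)%E.

Definition stability_region (d : nat) : set R :=
  [set lambda | 0 <= lambda /\
    exists2 q : {set 'I_N} -> R, static_policy d q & stable lambda d q].

End system.

Definition fast_slow_speed (R : realType) (N : nat) (rfast rslow : R)
  (i j : 'I_N) : R := if i == j then rfast else rslow.

(* Main.v *)
(* As x decreases to 0, the stability region for d < N shrinks to {0} while the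
   one for d = N does not. If d < N, every set I of d servers misses some j, and
   a type-j job sent to I is slow everywhere: with a probability bounded below
   it adds at least c / r_slow to the total workload W. Testing stationarity on
   exp (- s W), with s proportional to r_slow, bounds lambda by C r_slow.
   If d = N and the chain starts from equal workloads, they remain equal and
   follow the Lindley recursion w -> max 0 (w + B - tau), where
   E[B] <= \sum_j p_j E[X_j] E[S_j] / r_fast uniformly in r_slow. When
   lambda E[B] < 1 an excursion from 0 has finite mean length: because tau is
   exponential, w + 1 / lambda, set to 0 once the excursion is over, decreases
   on average by at least 1 / lambda - E[B] at each step. Normalising the
   occupation measure of an excursion gives a stationary law. *)

Require Import Defs.
From HB Require Import structures.
From mathcomp Require Import all_boot all_order all_algebra.
From mathcomp Require Import all_classical all_reals all_analysis.
From mathcomp Require Import measurable_realfun interval_inference giry.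
From mathcomp Require Import ring lra.

Set Implicit Arguments.
Unset Strict Implicit.
Unset Printing Implicit Defensive.

Import Order.TTheory GRing.Theory Num.Theory.
Import numFieldNormedType.Exports.

Local Open Scope classical_set_scope.
Local Open Scope ring_scope.

(** * Integration *)

(** On nonnegative workloads exp (- s W) lies between 0 and 1, so its integral F under a stationary
    law is finite and positive although nothing is known about the moments of that law; this is why
    W itself is not the test function. Let beta bound from below the processing times of a slow job.
    With s = 1 / beta such a job multiplies exp (- s W) by at most exp (- 1), and the time tau until
    the next arrival multiplies it by at most exp (s N tau), whose mean is lambda / (lambda - s N).
    If a job is slow on its servers with probability at least eta, whatever the set I, stationarity
    gives F <= F (1 - (1 - exp (- 1)) eta) lambda / (lambda - s N). Cancelling F leaves lambda eta
    (1 - exp (- 1)) <= N / beta, and beta is of order 1 / r_slow. Stationarity is given on sets; to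
    integrate test functions, the law after one transition is written as a finite mixture of images
    of product measures. *)

Section density.
Context d (T : measurableType d) (R : realType).
Variables (mu nu : {measure set T -> \bar R}) (g : T -> R).
Hypotheses (g_ge0 : forall x, 0 <= g x) (mg : measurable_fun setT g).
Hypothesis nuE : forall A, measurable A ->
  nu A = (\int[mu]_(x in A) (g x)%:E)%E.
Local Open Scope ereal_scope.

Import HBNNSimple.

Let mEg : measurable_fun setT (fun x => (g x)%:E).
Proof. exact/measurable_EFinP. Qed.

Let integral_density_nnsfun (h : {nnsfun T >-> R}) :
  \int[nu]_x (h x)%:E = \int[mu]_x ((h x)%:E * (g x)%:E).
Proof.
under [LHS]eq_integral do rewrite fimfunE -fsumEFin//.
under [RHS]eq_integral.
  move=> x _; rewrite fimfunE -fsumEFin// ge0_mule_fsuml; last first.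
    by move=> r; exact: nnfun_muleindic_ge0.
  over.
rewrite [LHS]ge0_integral_fsum//; last 2 first.
  - by move=> r; exact/measurable_EFinP/measurableT_comp.
  - by move=> r x _; exact: nnfun_muleindic_ge0.
rewrite [RHS]ge0_integral_fsum//; last 2 first.
  - move=> r; apply: emeasurable_funM => //.
    exact/measurable_EFinP/measurableT_comp.
  - by move=> r x _; rewrite mule_ge0 ?lee_fin//; exact: nnfun_muleindic_ge0.
apply: eq_fsbigr => r rh.
have r0 : (0 <= r)%R by move: rh => /[!inE] -[x _ <-].
under [LHS]eq_integral do rewrite EFinM.
rewrite integralZl_indic_nnsfun//.
under [RHS]eq_integral do rewrite EFinM -muleA.
rewrite [RHS]ge0_integralZl//; last 2 first.
- by apply: emeasurable_funM => //; exact/measurable_EFinP.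
- by move=> x _; rewrite mule_ge0 ?lee_fin.
rewrite integral_indic// setIT nuE; last exact: measurable_sfunP.
rewrite integral_mkcond; congr (_ * _); apply: eq_integral => x _.
by rewrite epatch_indic/= muleC.
Qed.

(** Linearity gives the case of simple functions and monotone convergence the rest. It serves both
    for the exponential density and for the indicator of a half-line. *)
Lemma ge0_integral_density (f : T -> \bar R) :
  measurable_fun setT f -> (forall x, 0 <= f x) ->
  \int[nu]_x f x = \int[mu]_x (f x * (g x)%:E).
Proof.
move=> mf f0; pose h := nnsfun_approx measurableT mf.
have hf x : (h n x)%:E @[n --> \oo] --> f x by exact: cvg_nnsfun_approx.
have ndh x m n : (m <= n)%N -> (h m x <= h n x)%R.
  by move=> mn; exact/lefP/nd_nnsfun_approx.
transitivity (limn (fun n => \int[nu]_x (h n x)%:E)).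
  rewrite -monotone_convergence//=.
  - by apply: eq_integral => x _; apply/esym/cvg_lim => //; exact: hf.
  - by move=> n; exact/measurable_EFinP.
  - by move=> n x _; rewrite lee_fin.
  - by move=> x _ m n mn; rewrite lee_fin ndh.
transitivity (limn (fun n => \int[mu]_x ((h n x)%:E * (g x)%:E))).
  by apply: congr_lim; apply/funext => n; exact: integral_density_nnsfun.
rewrite -monotone_convergence//=.
- apply: eq_integral => x _; apply/cvg_lim => //.
  by apply: cvgeZr => //; exact: hf.
- by move=> n; apply: emeasurable_funM => //; exact/measurable_EFinP.
- by move=> n x _; rewrite mule_ge0 ?lee_fin.
- by move=> x _ m n mn; rewrite lee_wpmul2r ?lee_fin// ndh.
Qed.

End density.

(** * Exponential moments and overshoot of the exponential law *)

Section exponential.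
Context {R : realType} (lambda : R).
Hypothesis lambda_gt0 : 0 < lambda.

Let expR_prob : probability (measurableTypeR R) R :=
  exponential_distribution_exponential_prob__canonical__probability_measure_Probability
    lambda_gt0.

(* The library puts exponential_prob and lebesgue_measure on measurableTypeR R,
   whose measurable sets are those of R but whose display differs. *)
Let measurable_idR : measurable_fun setT (idfun : measurableTypeR R -> R).
Proof. by move=> _ A mA; rewrite setTI. Qed.

HB.instance Definition _ := isMeasurableFun.Build _ _ (measurableTypeR R) R
  (idfun : measurableTypeR R -> R) measurable_idR.

Lemma exponential_prob_probability :
  exists e : probability R R, (e : set R -> \bar R) = exponential_prob lambda.
Proof.
by exists (distribution expR_prob (idfun : {mfun measurableTypeR R >-> R})).
Qed.

Variable e : probability R R.
Hypothesis eE : (e : set R -> \bar R) = exponential_prob lambda.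

Lemma ge0_integral_exponential_prob (f : R -> \bar R) :
  measurable_fun setT f -> (forall x, 0 <= f x)%E ->
  (\int[e]_x f x =
   \int[lebesgue_measure]_x (f x * (exponential_pdf lambda x)%:E))%E.
Proof.
move=> mf f0.
have mpdf : measurable_fun [set: measurableTypeR R] (exponential_pdf lambda).
  exact: measurable_exponential_pdf.
transitivity (\int[distribution expR_prob
    (idfun : {mfun measurableTypeR R >-> R})]_x f x)%E.
  by apply: eq_measure_integral => A mA _; exact: (congr1 (@^~ A) eE).
rewrite ge0_integral_distribution//.
apply: (ge0_integral_density _ mpdf) => //.
by move=> x; exact/exponential_pdf_ge0/ltW.
Qed.

(** Up to the factor lambda / (lambda - s), the density of rate lambda tilted by exp (s t) is the
    density of rate lambda - s. *)
Lemma integral_exponential_prob_expR (s : R) : 0 <= s -> s < lambda ->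
  (\int[e]_t (expR (s * `|t|))%:E = (lambda / (lambda - s))%:E)%E.
Proof.
move=> s0 sl.
have mexp : measurable_fun setT (fun t : R => (expR (s * `|t|))%:E).
  apply/measurable_EFinP; apply: measurableT_comp => //.
  exact: measurable_funM.
rewrite ge0_integral_exponential_prob//.
have ls : 0 < lambda - s by rewrite subr_gt0.
transitivity (\int[lebesgue_measure]_t ((lambda / (lambda - s))%:E *
    (exponential_pdf (lambda - s) t)%:E))%E.
  apply: eq_integral => t _; rewrite -!EFinM; congr EFin.
  have [t0|t0] := ltP t 0; first by rewrite !lt0_exponential_pdf// !mulr0.
  rewrite !exponential_pdfE// ger0_norm// [LHS]mulrC -mulrA -expRD mulrA.
  rewrite divfK ?gt_eqF//; congr (_ * expR _); ring.
rewrite ge0_integralZl//.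
- by rewrite integral_exponential_pdf// mule1.
- by apply/measurable_EFinP; exact: measurable_exponential_pdf.
- by move=> t _; rewrite lee_fin exponential_pdf_ge0// ltW.
- by rewrite lee_fin divr_ge0// ltW.
Qed.

(* Equality holds: when an exponential clock stops a positive workload c, the
   mean idle time 1 / lambda makes up for the mean overshoot. *)
Lemma integral_exponential_prob_overshoot (c : R) :
  (\int[e]_t (if 0 < c - t then c - t + lambda^-1 else 0)%:E <=
   (Num.max c 0)%:E)%E.
Proof.
(* For c > 0, [f] is the integrand times the exponential density on [0, c], and [F] is its primitive
   with values - c at 0 and 0 at c. *)
pose f (t : R) : R := (lambda * (c - t) + 1) * expR (- lambda * t).
pose F (t : R) : R := - (c - t) * expR (- lambda * t).
have dF x : @is_derive R R^o R^o x 1 F (f x).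
  rewrite /F /f; apply: is_derive_eq.
  rewrite /GRing.scale/=; ring.
have cf : continuous f.
  move=> x; apply: (@differentiable_continuous _ R^o R^o).
  exact/derivable1_diffP/ex_derive.
have mF : measurable_fun setT
    (fun t : R => (if 0 < c - t then c - t + lambda^-1 else 0)%:E).
  apply/measurable_EFinP; apply: measurable_fun_if => //.
  - by apply: measurable_fun_ltr => //; exact: measurable_funB.
  - by apply: measurable_funD => //; exact: measurable_funB.
have J0 t : 0 <= (if 0 < c - t then c - t + lambda^-1 else 0) :> R.
  by case: ifPn => // ct; rewrite addr_ge0 ?ltW ?invr_gt0.
rewrite ge0_integral_exponential_prob//.
have [c0|c0] := leP c 0.
  rewrite integral0_eq ?lee_fin// => t _; rewrite -EFinM.
  have [t0|t0] := ltP t 0; first by rewrite lt0_exponential_pdf ?mulr0.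
  by rewrite ltNge subr_le0 (le_trans c0)// mul0r.
have -> : c%:E = (\int[lebesgue_measure]_(t in `[0%R, c]) (f t)%:E)%E.
  rewrite (@continuous_FTC2 _ f F)//.
  - by rewrite /F -EFinB mulr0 expR0; congr EFin; ring.
  - exact: continuous_subspaceT.
  - split.
    + by move=> x _; exact: ex_derive.
    + apply: cvg_at_right_filter; apply: (@differentiable_continuous _ R^o R^o).
      exact/derivable1_diffP/ex_derive.
    + apply: cvg_at_left_filter; apply: (@differentiable_continuous _ R^o R^o).
      exact/derivable1_diffP/ex_derive.
  - by move=> x _; rewrite derive1E derive_val.
have f0 t : (0 <= t <= c) -> 0 <= f t.
  move=> /andP[_ tc]; rewrite mulr_ge0 ?expR_ge0// addr_ge0//.
  rewrite mulr_ge0 ?subr_ge0//.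
  exact: ltW.
have mf : measurable_fun setT (fun t => (f t)%:E).
  by apply/measurable_EFinP; exact: continuous_measurable_fun.
rewrite [leRHS]integral_mkcond; apply: ge0_le_integral => //=.
- move=> t _; rewrite mule_ge0 ?lee_fin// exponential_pdf_ge0//.
  exact: ltW.
- apply: emeasurable_funM => //; apply/measurable_EFinP.
  exact: measurable_exponential_pdf.
- apply/(measurable_restrictT _ _).1 => //; exact: measurable_funTS.
- move=> t _; rewrite patchE mem_setE in_itv/=.
  have [t0|t0]/= := leP 0 t; last by rewrite lt0_exponential_pdf// mule0.
  have [tc|tc] := leP t c; last first.
    by rewrite subr_gt0 ltNge (ltW tc) mul0e.
  case: ifPn => ct; last by rewrite mul0e lee_fin f0// t0.
  rewrite exponential_pdfE// -EFinM lee_fin mulrA ler_wpM2r ?expR_ge0//.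
  by rewrite mulrDl mulVf ?gt_eqF// (mulrC lambda).
Qed.

End exponential.

(** * Finite mixtures, product measures and iterated integrals *)

Section finite_mixture.
Context d (T : measurableType d) (R : realType) (I : finType).
Variables (c : I -> R) (m : I -> {measure set T -> \bar R}).
Hypothesis c_ge0 : forall i, 0 <= c i.
Local Open Scope ereal_scope.

(** [msum] adds a sequence of measures, so the components are numbered through [enum_val]; indices
    from the cardinal of [I] on carry the zero measure. *)
Let part (k : nat) : {measure set T -> \bar R} :=
  if insub k is Some o
  then mscale (NngNum (c_ge0 (enum_val (o : 'I_#|I|)))) (m (enum_val o))
  else mzero.

(** Turns a finite sum of laws into a single measure, so that an identity between measures of sets
    yields one between integrals. *)
Lemma finite_mixtureP : exists mu : {measure set T -> \bar R},
  (forall A, mu A = \sum_(i : I) (c i)%:E * m i A) /\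
  (forall f, measurable_fun setT f -> (forall x, 0 <= f x) ->
    \int[mu]_x f x = \sum_(i : I) (c i)%:E * \int[m i]_x f x).
Proof.
have partE (o : 'I_#|I|) : part o =
    mscale (NngNum (c_ge0 (enum_val o))) (m (enum_val o)).
  by rewrite /part valK.
exists (msum part #|I|); split.
  move=> A; rewrite /= /msum
    [RHS](reindex_onto enum_val enum_rank)/=; last first.
    by move=> i _; rewrite enum_rankK.
  rewrite [RHS](eq_bigl xpredT)/=; last by move=> o; rewrite enum_valK eqxx.
  by apply: eq_bigr => o _; rewrite partE.
move=> f mf f0; rewrite ge0_integral_measure_sum//.
rewrite [RHS](reindex_onto enum_val enum_rank)/=; last first.
  by move=> i _; rewrite enum_rankK.
rewrite [RHS](eq_bigl xpredT)/=; last by move=> o; rewrite enum_valK eqxx.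
by apply: eq_bigr => o _; rewrite partE ge0_integral_mscale.
Qed.

End finite_mixture.

Section product_integral.
Context d1 d2 (T1 : measurableType d1) (T2 : measurableType d2) (R : realType).
Local Open Scope ereal_scope.

Lemma ge0_integral_pushforward_prod d3 (T3 : measurableType d3)
  (m1 : {sigma_finite_measure set T1 -> \bar R})
  (m2 : {sigma_finite_measure set T2 -> \bar R})
  (phi : T1 * T2 -> T3) (f : T3 -> \bar R) :
  measurable_fun setT phi -> measurable_fun setT f -> (forall x, 0 <= f x) ->
  \int[pushforward (m1 \x m2) phi]_z f z =
  \int[m1]_x \int[m2]_y f (phi (x, y)).
Proof.
move=> mphi mf f0; rewrite ge0_integral_pushforward// preimage_setT.
rewrite fubini_tonelli1//; first exact: measurableT_comp.
by move=> x; exact: f0.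
Qed.

End product_integral.

Section iterated_integral.
Context d1 d2 d3 (T1 : measurableType d1) (T2 : measurableType d2)
  (T3 : measurableType d3) (R : realType).
Variables (m1 : probability T1 R) (m2 : probability T2 R)
  (m3 : probability T3 R).
Local Open Scope ereal_scope.

Let g1 : giry T1 R := (m1 : subprobability T1 R).
Let g2 : giry T2 R := (m2 : subprobability T2 R).
Let g3 : giry T3 R := (m3 : subprobability T3 R).

Lemma ge0_integral_prod3 (h : T1 * (T2 * T3) -> \bar R) :
  measurable_fun setT h -> (forall x, 0 <= h x) ->
  \int[giry_prod (g1, giry_prod (g2, g3))]_x h x =
  \int[m1]_x \int[m2]_y \int[m3]_z h (x, (y, z)).
Proof.
move=> mh h0.
transitivity (\int[m1]_x \int[giry_prod (g2, g3)]_y h (x, y)).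
  exact: fubini_tonelli1.
apply: eq_integral => x _; apply: (fubini_tonelli1 (fun y => h (x, y))) => //.
exact: measurableT_comp.
Qed.

(** Passing to the product measure replaces three nested comparisons, each with measurable partial
    integrals, by a single one. *)
Lemma ge0_le_integral3 (h1 h2 : T1 * (T2 * T3) -> \bar R) :
  measurable_fun setT h1 -> measurable_fun setT h2 ->
  (forall x, 0 <= h1 x) -> (forall x, h1 x <= h2 x) ->
  \int[m1]_x \int[m2]_y \int[m3]_z h1 (x, (y, z)) <=
  \int[m1]_x \int[m2]_y \int[m3]_z h2 (x, (y, z)).
Proof.
move=> mh1 mh2 h10 h12.
have h20 x : 0 <= h2 x by exact: le_trans (h12 x).
by rewrite -!ge0_integral_prod3//; apply: ge0_le_integral.
Qed.

Lemma integral3_separable (f : T1 -> R) (g : T2 -> R) (k : T3 -> R) :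
  measurable_fun setT f -> measurable_fun setT g -> measurable_fun setT k ->
  (forall x, 0 <= f x)%R -> (forall x, 0 <= g x)%R -> (forall x, 0 <= k x)%R ->
  \int[m1]_x \int[m2]_y \int[m3]_z (f x * (g y * k z))%:E =
  \int[m1]_x (f x)%:E * (\int[m2]_y (g y)%:E * \int[m3]_z (k z)%:E).
Proof.
move=> mf mg mk f0 g0 k0.
pose Eg := \int[m2]_y (g y)%:E; pose Ek := \int[m3]_z (k z)%:E.
have Eg0 : 0 <= Eg by apply: integral_ge0 => y _; rewrite lee_fin.
have Ek0 : 0 <= Ek by apply: integral_ge0 => z _; rewrite lee_fin.
transitivity (\int[m1]_x ((f x)%:E * (Eg * Ek))).
  apply: eq_integral => x _.
  transitivity (\int[m2]_y ((f x)%:E * ((g y)%:E * Ek))).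
    apply: eq_integral => y _.
    under eq_integral do rewrite mulrA EFinM.
    rewrite ge0_integralZl//; first by rewrite EFinM muleA.
    - exact/measurable_EFinP.
    - by move=> z _; rewrite lee_fin.
    - by rewrite lee_fin mulr_ge0.
  rewrite ge0_integralZl//; last 3 first.
  - by apply: emeasurable_funM => //; exact/measurable_EFinP.
  - by move=> y _; rewrite mule_ge0 ?lee_fin.
  - by rewrite lee_fin.
  congr (_ * _); rewrite ge0_integralZr//.
  - exact/measurable_EFinP.
  - by move=> y _; rewrite lee_fin.
rewrite ge0_integralZr//.
- exact/measurable_EFinP.
- by move=> x _; rewrite lee_fin.
- exact: mule_ge0.
Qed.

End iterated_integral.

(** * A stationary law of the Lindley recursion *)

Section lindley.
Context (R : realType) (K : probability R R) (h eps : R).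
Hypotheses (h_gt0 : 0 < h) (eps_gt0 : 0 < eps).
(** The strict inequality kills the excursion as soon as the recursion reaches 0, so that 0 is
    visited only at the start. *)
Let step (wz : R * R) : R :=
  if wz.1 < 0 then -1 else if 0 < wz.1 + wz.2 then wz.1 + wz.2 else -1.

Let mstep : measurable_fun setT step.
Proof.
have mD : measurable_fun setT (fun wz : R * R => wz.1 + wz.2).
  exact: measurable_funD.
have mlt : measurable_fun setT (fun wz : R * R => 0 < wz.1 + wz.2).
  by apply: measurable_fun_ltr.
have mlt0 : measurable_fun setT (fun wz : R * R => wz.1 < 0).
  by apply: measurable_fun_ltr.
apply: measurable_fun_if => //.
apply: measurable_fun_if => //.
- exact: mlt0.
- exact: measurable_funTS.
- exact: measurable_funTS.
Qed.

Local Open Scope ereal_scope.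
Hypothesis drift : forall w : R,
  \int[K]_z (if 0 < w + z then w + z + h else 0)%R%:E + eps%:E <=
  (Num.max w 0 + h)%:E.

Let KG : giry R R := (K : subprobability R R).

(* Excursion of the chain from 0, stopped when it returns to 0: -1 is a
   cemetery and the other states are nonnegative. *)
Let law : nat -> giry R R := fix law n :=
  if n is n'.+1 then giry_map mstep (giry_prod (law n', KG))
  else (\d_(0%R : R) : subprobability R R).

Let D : set R := `[0%R, +oo[%classic.

Let mD : measurable D. Proof. exact: measurable_itv. Qed.

Let DE (x : R) : D x = (0 <= x)%R :> Prop.
Proof. by rewrite /D/= in_itv/= andbT. Qed.

Let lawS n (B : set R) : law n.+1 B = \int[law n]_w K [set z | B (step (w, z))].
Proof.
rewrite /= /pushforward /product_measure1/=; apply: eq_integral => w _.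
by congr (K _); rewrite xsectionE.
Qed.

Let measurable_K_step (B : set (R * R)) : measurable B ->
  measurable_fun setT (fun w => K [set z | B (w, z)]).
Proof.
move=> mB; have := measurable_fun_xsection K mB; congr measurable_fun.
by apply/funext => w/=; rewrite xsectionE.
Qed.

Let measurable_lindley (A : set R) : measurable A ->
  measurable_fun setT (fun w : R => K [set z | A (Num.max 0 (w + z))]%R).
Proof.
move=> mA; pose m (wz : R * R) : R := Num.max 0%R (wz.1 + wz.2)%R.
have mm : measurable_fun setT m.
  by apply: measurable_maxr => //; exact: measurable_funD.
apply: (@measurable_K_step (m @^-1` A)).
by rewrite -[X in measurable X]setTI; exact: mm.
Qed.

Let lawS_integral n (f : R -> \bar R) : measurable_fun setT f ->
  (forall x, 0 <= f x) ->
  \int[law n.+1]_x f x = \int[law n]_w \int[K]_z f (step (w, z)).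
Proof. by move=> mf f0; exact: ge0_integral_pushforward_prod. Qed.

Let H (x : R) : R := if (x < 0)%R then 0%R else (x + h)%R.

Let H_ge0 x : (0 <= H x)%R.
Proof. by rewrite /H; case: ltP => // x0; rewrite addr_ge0// ltW. Qed.

Let mH : measurable_fun setT (fun x => (H x)%:E).
Proof.
apply/measurable_EFinP; apply: measurable_fun_if => //.
  by apply: measurable_fun_ltr.
by apply: measurable_funTS; exact: measurable_funD.
Qed.

(** [law n D] is the probability that the excursion still runs at step n. On that event the mean of
    [H] drops by at least [eps]; in the cemetery both sides vanish. *)
Let H_drift n :
  \int[law n.+1]_x (H x)%:E + eps%:E * law n D <= \int[law n]_x (H x)%:E.
Proof.
have mI : measurable_fun setT (fun w => \int[K]_z (H (step (w, z)))%:E).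
  apply: (@measurable_fun_fubini_tonelli_F _ _ _ _ _ K
    (fun wz => (H (step wz))%:E)).
  - exact: (measurableT_comp mH mstep).
  - by move=> x; rewrite lee_fin.
have mE : measurable_fun setT (fun x => eps%:E * (\1_D x)%:E).
  by apply: measurable_funeM; exact/measurable_EFinP/measurable_indic.
rewrite lawS_integral//.
rewrite -(setIT D) -(integral_indic (law n) measurableT mD).
rewrite -ge0_integralZl//; last 2 first.
- exact/measurable_EFinP/measurable_indic.
- by rewrite lee_fin ltW.
rewrite -ge0_integralD//; last 2 first.
- by move=> x _; apply: integral_ge0 => z _; rewrite lee_fin.
- by move=> x _; rewrite -EFinM lee_fin mulr_ge0// ltW.
apply: ge0_le_integral => //.
- move=> x _; rewrite adde_ge0//.
    by apply: integral_ge0 => z _; rewrite lee_fin.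
  by rewrite -EFinM lee_fin mulr_ge0// ltW.
- exact: emeasurable_funD.
- move=> w _; rewrite indicE/=; have [w0|w0] := ltP w 0%R.
    rewrite memNset; last by rewrite DE leNgt w0.
    rewrite mule0 adde0 integral0_eq ?lee_fin// => z _.
    by rewrite /step/= w0 /H ltrN10.
  rewrite mem_set ?DE// mule1 [in leRHS]/H ltNge w0/=.
  have := drift w; rewrite (max_idPl w0); apply: le_trans.
  rewrite leeD2r// le_eqVlt; apply/orP; left; apply/eqP.
  apply: eq_integral => z _; rewrite /step/= ltNge w0/= /H.
  by have [wz|wz] := ltP 0%R (w + z)%R; [rewrite ltNge (ltW wz)|rewrite ltrN10].
Qed.

(** [H_drift] telescopes, starting from the value [h] of [H] at 0. The sum is the mean length of the
    excursion. *)
Let sum_mass_le : \sum_(n <oo) law n D <= (h / eps)%:E.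
Proof.
have H0 : \int[law 0%N]_x (H x)%:E = h%:E.
  by rewrite /= integral_dirac//= diracT mul1e /H ltxx add0r.
have sumH n : eps%:E * \sum_(0 <= k < n) law k D + \int[law n]_x (H x)%:E
    <= h%:E.
  elim: n => [|n ih]; first by rewrite big_geq// mule0 add0e H0.
  rewrite big_nat_recr//= ge0_muleDr//; last exact: sume_ge0.
  rewrite -addeA (le_trans _ ih)// leeD2l// addeC.
  exact: H_drift.
apply: lime_le; first exact: is_cvg_nneseries.
apply: nearW => n; rewrite EFinM lee_pdivlMr//.
rewrite muleC (le_trans _ (sumH n))// leeDl//.
by apply: integral_ge0 => x _; rewrite lee_fin.
Qed.

(** Mean number of visits during the excursion; the restriction to [D] discards the cemetery. *)
Let occ : {measure set R -> \bar R} := mseries (fun n => mrestr (law n) mD) 0.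

Let occE A : occ A = \sum_(n <oo) law n (A `&` D).
Proof. by []. Qed.

Let lawSD n A : law n.+1 (A `&` D) =
  \int[law n]_w K [set z | (A `&` D) (step (w, z))].
Proof. exact: lawS. Qed.

(** Probability that the excursion ends exactly at step n + 1. *)
Let hit n : \bar R := \int[law n]_w ((\1_D w)%:E * K [set z | w + z <= 0]%R).

Let mhit : measurable_fun setT
  (fun w : R => (\1_D w)%:E * K [set z | w + z <= 0]%R).
Proof.
apply: emeasurable_funM; first exact/measurable_EFinP/measurable_indic.
apply: (@measurable_K_step [set wz : R * R | wz.1 + wz.2 <= 0]%R).
rewrite -[X in measurable X]setTI.
have : measurable_fun setT (fun wz : R * R => wz.1 + wz.2 <= 0)%R.
  by apply: measurable_fun_ler => //; exact: measurable_funD.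
by move/(_ measurableT [set true] I); congr measurable.
Qed.

(** From a running state the Lindley recursion either stays positive, as the excursion does, or is
    truncated to 0 where the excursion is killed; the last term puts that lost mass back at 0. *)
Let law_step n (A : set R) : measurable A ->
  \int[law n]_w ((\1_D w)%:E * K [set z | A (Num.max 0 (w + z))]%R) =
  law n.+1 (A `&` D) + (\1_A (0%R : R))%:E * hit n.
Proof.
move=> mA; have mAD : measurable (A `&` D) by exact: measurableI.
rewrite lawSD /hit -ge0_integralZl//; last first.
  by move=> w _; rewrite mule_ge0 ?lee_fin.
rewrite -ge0_integralD//; last 3 first.
- apply: (@measurable_K_step (step @^-1` (A `&` D))).
  by rewrite -[X in measurable X]setTI; exact: mstep.
- by move=> w _; rewrite !mule_ge0 ?lee_fin.
- exact: measurable_funeM.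
apply: eq_integral => w _; rewrite indicE.
have [w0|w0] := ltP w 0%R.
  rewrite memNset; last by rewrite DE leNgt w0.
  rewrite !mul0e mule0 adde0 (_ : mkset _ = set0) ?measure0//.
  by apply/seteqP; split => // z [_]; rewrite DE /step/= w0 ler0N1.
rewrite mem_set ?DE// !mul1e.
have mwz : measurable_fun setT (fun z => w + z)%R by exact: measurable_funD.
have mle : measurable [set z | w + z <= 0]%R.
  have : measurable_fun setT (fun z => w + z <= 0)%R.
    by apply: measurable_fun_ler.
  by move/(_ measurableT [set true] I); rewrite setTI.
have stepE z : (A `&` D) (step (w, z)) <-> (0 < w + z)%R /\ A (w + z)%R.
  rewrite /step/= ltNge w0/=; split.
    by case: ifPn => [wz [] //|_ []]; rewrite DE ler0N1.
  by move=> [wz Awz]; rewrite wz; split=> //; rewrite DE ltW.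
have msE : measurable [set z | (A `&` D) (step (w, z))].
  have : measurable_fun setT (fun z => step (w, z)).
    exact: measurableT_comp.
  by move/(_ measurableT _ mAD); rewrite setTI.
have [A0|A0] := boolP (0%R \in A).
  rewrite indicE A0 mul1e -measureU//; last first.
    apply/seteqP; split => // z [/stepE[wz _] /=]; by rewrite leNgt wz.
  congr (K _); apply/seteqP; split => z /=.
    have [wz|wz] := leP (w + z)%R 0%R; first by right.
    by move=> Awz; left; apply/stepE.
  move=> [/stepE[wz Awz]|wz]; first by rewrite (max_idPr (ltW wz)).
  by rewrite (max_idPl wz); exact/set_mem.
rewrite indicE (negbTE A0) mul0e adde0; congr (K _).
apply/seteqP; split => z /=.
  have [wz|wz] := leP (w + z)%R 0%R.
    by move=> /mem_set; rewrite (negbTE A0).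
  by move=> Awz; apply/stepE.
by move=> /stepE[wz Awz]; rewrite (max_idPr (ltW wz)).
Qed.

Let law0 A : law 0%N (A `&` D) = (\1_A (0%R : R))%:E.
Proof.
rewrite /= diracE indicE; congr (_%:R%:E); congr (nat_of_bool _).
apply/idP/idP => /set_mem; first by case=> /mem_set.
by move=> A0; apply/mem_set; split=> //; rewrite DE.
Qed.

Let sum_lawS A : occ A =
  (\1_A (0%R : R))%:E + \sum_(n <oo) law n.+1 (A `&` D).
Proof.
rewrite occE nneseries_recl//; congr (_ + _); first exact: law0.
by rewrite -nneseries_addn//; apply: eq_eseriesr => n _; rewrite addn1.
Qed.

Let occ_lty : occ setT < +oo.
Proof.
by rewrite occE setTI (le_lt_trans sum_mass_le)// ltry.
Qed.

Let hit_ge0 n : 0 <= hit n.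
Proof. by apply: integral_ge0 => w _; rewrite mule_ge0 ?lee_fin. Qed.

(** The excursion ends almost surely: its mass loses [hit n] from step n to n + 1, and the losses
    add up to the initial mass 1. The series of masses cancels because it is finite. *)
Let sum_hit : \sum_(n <oo) hit n = 1.
Proof.
have massE n : law n (setT `&` D) = law n.+1 (setT `&` D) + hit n.
  have := law_step n measurableT.
  rewrite indicE in_setT mul1e => <-.
  rewrite setTI -[D in LHS]setIT -(integral_indic (law n) measurableT mD).
  by apply: eq_integral => w _; rewrite probability_setT mule1.
have := sum_lawS setT; rewrite occE.
rewrite (eq_eseriesr (fun n _ => massE n)) nneseriesD// addeC.
have fin : \sum_(n <oo) law n.+1 (setT `&` D) \is a fin_num.
  rewrite ge0_fin_numE; last exact: nneseries_ge0.
  by apply: le_lt_trans occ_lty; rewrite sum_lawS leeDr// lee_fin.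
move=> /(congr1 (fun y => y - \sum_(n <oo) law n.+1 (setT `&` D))).
by rewrite !addeK// indicE in_setT.
Qed.

(** One transition shifts the laws of the excursion by one index. The initial unit mass at 0 is lost
    by the shift and restored by the returns to 0, whose total is [sum_hit]. *)
Lemma integral_lindley_occ (A : set R) : measurable A ->
  \int[occ]_w K [set z | A (Num.max 0 (w + z))]%R = occ A.
Proof.
move=> mA.
have mK := measurable_lindley mA.
rewrite ge0_integral_measure_series//.
transitivity (\sum_(n <oo) (law n.+1 (A `&` D) + (\1_A (0%R : R))%:E * hit n)).
  apply: eq_eseriesr => n _; rewrite -law_step//.
  rewrite (@ge0_integral_density _ _ _ (law n) _ \1_D)//.
  - by apply: eq_integral => w _; rewrite muleC.
  - by move=> B mB; rewrite integral_indic// setIC.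
rewrite nneseriesD//; last by move=> n _ _; rewrite mule_ge0 ?lee_fin.
by rewrite nneseriesZl// sum_hit mule1 sum_lawS addeC.
Qed.

Lemma lindley_stationary : exists nu : probability R R, forall A : set R,
  measurable A -> nu A = \int[nu]_w K [set z | A (Num.max 0 (w + z))]%R.
Proof.
(* The start at 0 alone contributes mass 1, so [occ] can be normalised. *)
have occ_gt0 : 0 < occ setT.
  rewrite sum_lawS indicE in_setT (@lt_le_trans _ _ 1)// leeDl//.
  exact: nneseries_ge0.
have occ_fin : occ setT \is a fin_num by rewrite ge0_fin_numE.
have c0 : (0 <= (fine (occ setT))^-1)%R by rewrite invr_ge0 fine_ge0.
exists (mnormalize occ K) => A mA.
have nuE B : mnormalize occ K B = mscale (NngNum c0) occ B.
  by rewrite /mnormalize gt_eqF//= lt_eqF//= /mscale/= muleC.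
rewrite (eq_measure_integral (mscale (NngNum c0) occ)); last first.
  by move=> B _ _; exact: nuE.
transitivity (mscale (NngNum c0) occ A); first exact: nuE.
rewrite ge0_integral_mscale//; first by rewrite integral_lindley_occ.
exact: measurable_lindley.
Qed.

End lindley.

(** * Workloads *)

Section workload.
Context {R : realType} (N : nat).
Implicit Types (w b : 'I_N -> R) (I : {set 'I_N}).

(** For a nonempty set of servers the infimum is a minimum; later arguments use [completion_time] in
    this form. *)
Lemma completion_timeP w b I : I != finset.set0 ->
  exists2 i, i \in I & completion_time w b I = w i + b i /\
    forall k, k \in I -> completion_time w b I <= w k + b k.
Proof.
case/set0Pn => i0 Ii0.
pose i := [arg min_(i < i0 in I) (w i + b i)]%O.
have [Ii imin] : i \in I /\ forall k, k \in I -> w i + b i <= w k + b k.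
  by rewrite /i; case: arg_minP.
have E : completion_time w b I = w i + b i.
  apply/eqP; rewrite eq_le; apply/andP; split.
    apply: ge_inf; last by exists i.
    by exists (w i + b i) => _ [k Ik <-]; exact: imin.
  by apply: lb_le_inf => [|_ [k Ik <-]]; [exists (w i + b i), i|exact: imin].
by exists i => //; split => // k Ik; rewrite E; exact: imin.
Qed.

Lemma completion_timeD (x : R) b I : I != finset.set0 ->
  completion_time (fun=> x) b I = x + completion_time (fun=> 0) b I.
Proof.
move=> I0; have [i Ii [-> imin]] := completion_timeP (fun=> x) b I0.
have [j Ij [-> jmin]] := completion_timeP (fun=> 0) b I0.
rewrite add0r; congr (_ + _); apply/eqP; rewrite eq_le; apply/andP; split.
  by have := imin _ Ij; rewrite lerD2l.
by have := jmin _ Ii; rewrite !add0r.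
Qed.

Lemma measurable_completion_time d (T : measurableType d)
    (W B : T -> 'I_N -> R) I :
  (forall i, measurable_fun setT (W ^~ i)) ->
  (forall i, measurable_fun setT (B ^~ i)) ->
  measurable_fun setT (fun x => completion_time (W x) (B x) I).
Proof.
move=> mW mB; have [->|I0] := eqVneq I finset.set0.
  rewrite (_ : (fun _ => _) = cst (inf (set0 : set R)))//.
  apply/funext => x; rewrite /completion_time/=; congr inf.
  by apply/seteqP; split => // t [i] /=; rewrite finset.inE.
have [i0 Ii0] := set0Pn _ I0.
pose f x i := W x i + B x i.
have mf i : measurable_fun setT (f ^~ i) by exact: measurable_funD.
rewrite (_ : (fun _ => _) =
    fun x => \big[Num.min/f x i0]_(i <- enum I) f x i); last first.
  apply/funext => x; have [i Ii [E imin]] := completion_timeP (W x) (B x) I0.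
  rewrite big_enum/=; apply/eqP; rewrite eq_le; apply/andP; split.
    by apply: le_bigmin => [|k]; exact: imin.
  by rewrite E; exact: bigmin_le_cond.
elim: (enum I) => [|i s ih].
  by under eq_fun do rewrite big_nil; exact: mf.
by under eq_fun do rewrite big_cons; exact: measurable_minr.
Qed.

Lemma measurable_next_workload d (T : measurableType d)
    (W : T -> N.-tuple R) (B : T -> 'I_N -> R) I (tau : T -> R) :
  measurable_fun setT W -> (forall i, measurable_fun setT (B ^~ i)) ->
  measurable_fun setT tau ->
  measurable_fun setT (fun x => next_workload (W x) (B x) I (tau x)).
Proof.
move=> /measurable_fun_tnthP mW mB mtau; apply/measurable_fun_tnthP => i.
rewrite (_ : _ \o _ = fun x =>
    Num.max 0 (workload_after (tnth (W x)) (B x) I i - tau x)); last first.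
  by apply/funext => x/=; rewrite tnth_mktuple.
apply: measurable_maxr => //; apply: measurable_funB => //.
rewrite /workload_after; case: (i \in I); last exact: mW.
by apply: measurable_maxr; [exact: mW|exact: measurable_completion_time].
Qed.

Lemma completion_time_ge0 b I : I != finset.set0 -> (forall i, 0 <= b i) ->
  0 <= completion_time (fun=> 0) b I.
Proof.
move=> I0 b0; have [k _ [-> _]] := completion_timeP (fun=> 0) b I0.
by rewrite add0r.
Qed.

(** All servers finish together, after [x] plus the smallest processing time; as this is at least
    [x], the maximum in [workload_after] disappears. *)
Lemma next_workload_cst (x : R) b I (tau : R) : I != finset.set0 ->
  (forall i, i \in I) -> (forall i, 0 <= b i) ->
  next_workload [tuple x | _ < N] b I tau =
  [tuple Num.max 0 (x + (completion_time (fun=> 0) b I - tau)) | _ < N].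
Proof.
move=> I0 IT b0; apply: eq_from_tnth => i.
rewrite !tnth_mktuple; congr Num.max.
rewrite /workload_after IT tnth_mktuple.
rewrite (_ : tnth _ = fun=> x); last first.
  by apply/funext => k; rewrite tnth_mktuple.
rewrite completion_timeD// addrA (max_idPr _)// lerDl.
exact: completion_time_ge0.
Qed.

Lemma next_workload_ge0 (w : N.-tuple R) b I tau i :
  0 <= tnth (next_workload w b I tau) i.
Proof. by rewrite tnth_mktuple le_max lexx. Qed.

(* The server of I with the least workload is busy with the job for at least
   the smallest processing time. *)
Lemma sum_next_workload_ge (w : N.-tuple R) b I tau beta :
  I != finset.set0 -> (forall i, i \in I -> beta <= b i) ->
  \sum_(i < N) tnth w i + beta - tau *+ N <=
  \sum_(i < N) tnth (next_workload w b I tau) i.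
Proof.
move=> I0 bb; have [i0 Ii0] := set0Pn _ I0.
pose m := [arg min_(i < i0 in I) tnth w i]%O.
have [Im mmin] : m \in I /\ forall k, k \in I -> tnth w m <= tnth w k.
  by rewrite /m; case: arg_minP.
have after_ge i : tnth w i <= workload_after (tnth w) b I i.
  by rewrite /workload_after; case: ifP => // _; rewrite le_max lexx.
have after_m : tnth w m + beta <= workload_after (tnth w) b I m.
  rewrite /workload_after Im le_max; apply/orP; right.
  have [k Ik [-> _]] := completion_timeP (tnth w) b I0.
  by rewrite lerD ?mmin ?bb.
apply: (@le_trans _ _ (\sum_(i < N) (workload_after (tnth w) b I i - tau))).
  rewrite sumrB sumr_const card_ord lerD2r (bigD1 m)//= [leRHS](bigD1 m)//=.
  by rewrite addrAC lerD// ler_sum.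
by apply: ler_sum => i _; rewrite tnth_mktuple le_max lexx orbT.
Qed.

End workload.

(** * Integrals against a stationary law of the workload chain *)

Section stationary_integral.
Context {R : realType} (N M : nat).
Context {dT : measure_display} {T : measurableType dT} (P : probability T R).
Variables (X : 'I_M -> {RV P >-> R}) (Y : 'I_N -> 'I_M -> {RV P >-> R}).
Variables (p : 'I_M -> R) (r : 'I_N -> 'I_M -> R).
Variables (lambda : R) (d : nat) (q : {set 'I_N} -> R).
Hypotheses (p_ge0 : forall j, 0 <= p j) (policy_q : static_policy d q).
Variable e : probability R R.
Hypothesis eE : (e : set R -> \bar R) = exponential_prob lambda.

Local Notation b j := (fun u i => processing_time X Y r j i u).

Lemma measurable_processing_time j i :
  measurable_fun setT (processing_time X Y r j i).
Proof. by apply: measurable_funM => //; exact: measurable_funM. Qed.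

Let next j I (x : (N.-tuple R) * (T * R)) :=
  next_workload x.1 (b j x.2.1) I x.2.2.

Let measurable_next j I : measurable_fun setT (next j I).
Proof.
apply: measurable_next_workload => //.
- by move=> i; apply: (measurableT_comp (measurable_processing_time j i));
    exact: measurableT_comp.
- exact: measurableT_comp.
Qed.

(** Set to 0 off the sets of [d] servers, where a static policy leaves the sign of [q] free: the
    mixture then runs over a whole finite type with nonnegative weights. *)
Let weight (jI : 'I_M * {set 'I_N}) : R :=
  if #|jI.2| == d then p jI.1 * q jI.2 else 0.

Let weight_ge0 jI : 0 <= weight jI.
Proof.
rewrite /weight; case: eqP => // Id; rewrite mulr_ge0//.
exact: policy_q.1.
Qed.

Local Open Scope ereal_scope.

Let sum_weight (F : 'I_M -> {set 'I_N} -> \bar R) :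
  \sum_jI (weight jI)%:E * F jI.1 jI.2 =
  \sum_(j < M) \sum_(I : {set 'I_N} | #|I| == d) (p j * q I)%:E * F j I.
Proof.
rewrite -(pair_bigA _ (fun j I => (weight (j, I))%:E * F j I))/=.
apply: eq_bigr => j _; rewrite [RHS]big_mkcond/=; apply: eq_bigr => I _.
by rewrite /weight/=; case: eqP => // _; rewrite mul0e.
Qed.

Variable pi : probability (N.-tuple R) R.

Let PG : giry T R := (P : subprobability T R).
Let eG : giry R R := (e : subprobability R R).
Let piG : giry (N.-tuple R) R := (pi : subprobability (N.-tuple R) R).

Let law (jI : 'I_M * {set 'I_N}) : giry (N.-tuple R) R :=
  giry_map (measurable_next jI.1 jI.2) (giry_prod (piG, giry_prod (PG, eG))).

Let lawE jI (A : set (N.-tuple R)) : law jI A =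
  \int[pi]_w \int[P]_u
    e [set tau | A (next_workload w (b jI.1 u) jI.2 tau)].
Proof.
rewrite /= /pushforward /product_measure1/=; apply: eq_integral => w _.
rewrite /product_measure1; apply: eq_integral => u _ /=.
by congr (e _); rewrite !xsectionE.
Qed.

Let measurable_section_next jI (A : set (N.-tuple R)) : measurable A ->
  measurable_fun setT (fun w =>
    \int[P]_u e [set tau | A (next_workload w (b jI.1 u) jI.2 tau)]).
Proof.
move=> mA.
have mB : measurable (next jI.1 jI.2 @^-1` A).
  by rewrite -[X in measurable X]setTI; exact: measurable_next.
have := measurable_fun_xsection (giry_prod (PG, eG)) mB; congr measurable_fun.
apply/funext => w; rewrite /= /product_measure1; apply: eq_integral => u _ /=.
by congr (e _); rewrite !xsectionE.
Qed.

Lemma measurable_workload_transition (A : set (N.-tuple R)) : measurable A ->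
  measurable_fun setT (fun w => workload_transition X Y p r lambda d q w A).
Proof.
move=> mA; under eq_fun do rewrite /workload_transition -eE -sum_weight.
apply: emeasurable_sum => jI; apply: measurable_funeM.
exact: measurable_section_next.
Qed.

Lemma workload_transition_ge0 (w : N.-tuple R) (A : set (N.-tuple R)) :
  0 <= workload_transition X Y p r lambda d q w A.
Proof.
rewrite /workload_transition -eE -sum_weight; apply: sume_ge0 => jI _.
by rewrite mule_ge0 ?lee_fin//; exact: integral_ge0.
Qed.

Let law_integral jI (f : N.-tuple R -> \bar R) :
  measurable_fun setT f -> (forall x, 0 <= f x) ->
  \int[law jI]_x f x = \int[pi]_w \int[P]_u \int[e]_tau
    f (next_workload w (b jI.1 u) jI.2 tau).
Proof.
move=> mf f0; pose m12 := giry_prod (PG, eG).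
transitivity (\int[pi]_w \int[m12]_y f (next jI.1 jI.2 (w, y))).
  exact: ge0_integral_pushforward_prod.
apply: eq_integral => w _.
rewrite /m12 (fubini_tonelli1 (fun y => f (next jI.1 jI.2 (w, y))))//.
apply: (measurableT_comp mf); apply: measurableT_comp => //.
Qed.

(** By invariance [pi] agrees on measurable sets with the mixture of the laws after one transition,
    hence has the same integrals. *)
Lemma ge0_integral_stationary :
  (forall A : set (N.-tuple R), measurable A ->
    pi A = \int[pi]_w workload_transition X Y p r lambda d q w A) ->
  forall f : N.-tuple R -> \bar R,
  measurable_fun setT f -> (forall x, 0 <= f x) ->
  \int[pi]_x f x =
  \sum_(j < M) \sum_(I : {set 'I_N} | #|I| == d) (p j * q I)%:E *
    \int[pi]_w \int[P]_u \int[e]_tau f (next_workload w (b j u) I tau).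
Proof.
move=> inv f mf f0.
have [mu [muE mu_int]] :=
  finite_mixtureP (fun jI => law jI : {measure set _ -> \bar R}) weight_ge0.
transitivity (\int[mu]_x f x).
  apply: eq_measure_integral => A mA _.
  transitivity (pi A) => //; rewrite inv// muE.
  under eq_integral do rewrite /workload_transition -eE -sum_weight.
  rewrite ge0_integral_sum//; last 2 first.
  - by move=> jI; apply: measurable_funeM; exact: measurable_section_next.
  - by move=> jI w _; rewrite mule_ge0 ?lee_fin//; exact: integral_ge0.
  apply: eq_bigr => jI _; rewrite ge0_integralZl ?lee_fin//.
  - by congr (_ * _); rewrite -lawE.
  - exact: measurable_section_next.
  - by move=> w _; exact: integral_ge0.
rewrite mu_int// -sum_weight; apply: eq_bigr => jI _; congr (_ * _).
exact: law_integral.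
Qed.

End stationary_integral.

(** * Upper bound on the arrival rate *)

Section instability.
Context {R : realType} (N M : nat).
Context {dT : measure_display} {T : measurableType dT} (P : probability T R).
Variables (X : 'I_M -> {RV P >-> R}) (Y : 'I_N -> 'I_M -> {RV P >-> R}).
Variables (p : 'I_M -> R) (r : 'I_N -> 'I_M -> R).
Variables (lambda : R) (d : nat) (q : {set 'I_N} -> R).
Hypotheses (p_ge0 : forall j, 0 <= p j) (p_sum : \sum_(j < M) p j = 1).
Hypotheses (d_gt0 : (0 < d)%N) (policy_q : static_policy d q).
Hypothesis time_ge0 : forall j i u, 0 <= processing_time X Y r j i u.
Variables (beta eta : R).
Hypotheses (beta_gt0 : 0 < beta) (eta_ge0 : 0 <= eta).
Hypothesis slow : forall I : {set 'I_N}, #|I| = d ->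
  exists (j : 'I_M) (E : set T), [/\ measurable E,
    forall u i, E u -> i \in I -> beta <= processing_time X Y r j i u &
    (eta%:E <= (p j)%:E * P E)%E].

Let card_neq0 (I : {set 'I_N}) : #|I| = d -> I != finset.set0.
Proof. by move=> Id; rewrite -card_gt0 Id. Qed.

Let s := beta^-1.

Let s_gt0 : 0 < s. Proof. by rewrite invr_gt0. Qed.

Let load (w : N.-tuple R) : R := expR (- s * \sum_(i < N) tnth w i).

Let mload : measurable_fun setT load.
Proof.
apply: measurableT_comp => //; apply: measurable_funM => //.
by apply: measurable_sum => i; exact: measurable_tnth.
Qed.

(** Applied with [b0 = beta] on the slow event and with [b0 = 0] off it. *)
Let load_next w (bt : 'I_N -> R) (I : {set 'I_N}) tau b0 :
  I != finset.set0 -> (forall i, i \in I -> b0 <= bt i) ->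
  load (next_workload w bt I tau) <=
  load w * (expR (- s * b0) * expR (s * N%:R * `|tau|)).
Proof.
move=> I0 bI; rewrite /load -!expRD ler_expR.
have := sum_next_workload_ge w tau I0 bI.
set S := \sum_(i < N) tnth w i; set S' := \sum_(i < N) _ => SS'.
have tN : tau *+ N <= N%:R * `|tau|.
  by rewrite -[leLHS]mulr_natl ler_wpM2l// ler_norm.
rewrite (_ : _ + (_ + _) = - s * (S + b0 - N%:R * `|tau|)); last by ring.
by rewrite !mulNr lerN2 ler_pM2l//; lra.
Qed.

Hypothesis lambda_gt : s * N%:R < lambda.
Variable e : probability R R.
Hypothesis eE : (e : set R -> \bar R) = exponential_prob lambda.
Variable pi : probability (N.-tuple R) R.
Hypothesis inv : forall A : set (N.-tuple R), measurable A ->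
    pi A = (\int[pi]_w workload_transition X Y p r lambda d q w A)%E.

Let lambda_gt0 : 0 < lambda.
Proof. by apply: le_lt_trans lambda_gt; rewrite mulr_ge0// ltW. Qed.

Let theta : R := expR (- 1).

Let theta_lt1 : theta < 1. Proof. by rewrite expR_lt1. Qed.

(** Mean of exp (s N tau) for an interarrival time tau, finite by [lambda_gt]. *)
Let L : R := lambda / (lambda - s * N%:R).

Let J j I : \bar R := (\int[pi]_w \int[P]_u \int[e]_tau
  (load (next_workload w (fun i => processing_time X Y r j i u) I tau))%:E)%E.

Let F : \bar R := (\int[pi]_w (load w)%:E)%E.

Let FE : F = (\sum_(j < M) \sum_(I : {set 'I_N} | #|I| == d)
  (p j * q I)%:E * J j I)%E.
Proof.
rewrite /F (ge0_integral_stationary p_ge0 policy_q eE inv)//.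
  exact/measurable_EFinP.
by move=> w; rewrite lee_fin expR_ge0.
Qed.

Let mnext (j : 'I_M) (I : {set 'I_N}) :
  measurable_fun setT (fun x : (N.-tuple R) * (T * R) =>
    (load (next_workload x.1
      (fun i => processing_time X Y r j i x.2.1) I x.2.2))%:E).
Proof.
apply/measurable_EFinP; apply: (measurableT_comp mload).
apply: measurable_next_workload => //.
- move=> i; apply: (measurableT_comp (measurable_processing_time X Y r j i)).
  exact: measurableT_comp.
- exact: measurableT_comp.
Qed.

(** [pi] is not assumed to be carried by nonnegative vectors, so [load] itself may exceed 1. After
    one transition the workloads are nonnegative, and stationarity transfers the bound to [F]. *)
Let J_le1 j I : (J j I <= 1)%E.
Proof.
pose h1 (x : (N.-tuple R) * (T * R)) := (load (next_workload x.1
      (fun i => processing_time X Y r j i x.2.1) I x.2.2))%:E.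
have : (J j I <= \int[pi]_w \int[P]_u \int[e]_tau cst 1 (w, (u, tau)))%E.
  apply: (@ge0_le_integral3 _ _ _ _ _ _ _ pi P e h1 (cst 1%E)) => //.
  - exact: mnext.
  - by move=> x; rewrite lee_fin expR_ge0.
  - move=> x; rewrite lee_fin /load expR_le1 mulNr oppr_le0.
    rewrite mulr_ge0//; first exact: ltW.
    by apply: sumr_ge0 => i _; exact: next_workload_ge0.
move=> /le_trans; apply.
rewrite -(ge0_integral_prod3 pi P e (h := cst 1%E))// integral_cst// mul1e.
exact: sprobability_setT.
Qed.

Let J_le j (I : {set 'I_N}) (E : set T) : #|I| = d -> measurable E ->
  (forall u i, E u -> i \in I -> beta <= processing_time X Y r j i u) ->
  (J j I <= F * ((1 - (1 - theta)%:E * P E) * L%:E))%E.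
Proof.
move=> Id mE bE.
(* The factor due to the job: [theta] on [E] and 1 elsewhere. The bound on [load] is then a product
   of functions of [w], [u] and [tau], integrated separately. *)
pose g u := 1 - (1 - theta) * \1_E u.
have th01 : 0 <= 1 - theta <= 1.
  by rewrite subr_ge0 ltW//= lerBlDr lerDl expR_ge0.
have g0 u : 0 <= g u.
  rewrite /g subr_ge0 indicE; case: (u \in E) => /=; last by rewrite mulr0.
  by rewrite mulr1; case/andP: th01.
have mg : measurable_fun setT g.
  apply: measurable_funB => //; apply: measurable_funM => //.
pose k (tau : R) := expR (s * N%:R * `|tau|).
have mk : measurable_fun setT k.
  apply: measurableT_comp => //; apply: measurable_funM => //.
have -> : (1 - (1 - theta)%:E * P E)%E = (\int[P]_u (g u)%:E)%E.
  under eq_integral do rewrite /g EFinB EFinM.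
  rewrite integralB//=.
  - rewrite integral_cst//= probability_setT mule1; congr (_ - _)%E.
    rewrite ge0_integralZl//.
    + by rewrite integral_indic// setIT.
    + exact/measurable_EFinP/measurable_indic.
    + by rewrite lee_fin; case/andP: th01.
  - exact: finite_measure_integrable_cst.
  - apply: integrableZl => //; exact: integrable_indic.
have -> : L%:E = (\int[e]_tau (k tau)%:E)%E.
  rewrite (integral_exponential_prob_expR lambda_gt0 eE)// mulr_ge0// ltW//.
have load_ge0 w : 0 <= load w by exact: expR_ge0.
have k0 tau : 0 <= k tau by exact: expR_ge0.
rewrite /F -(integral3_separable pi P e mload mg mk load_ge0 g0 k0).
pose h1 (x : (N.-tuple R) * (T * R)) := (load (next_workload x.1
      (fun i => processing_time X Y r j i x.2.1) I x.2.2))%:E.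
pose h2 (x : (N.-tuple R) * (T * R)) := (load x.1 * (g x.2.1 * k x.2.2))%:E.
apply: (@ge0_le_integral3 _ _ _ _ _ _ _ pi P e h1 h2) => //.
- exact: mnext.
- apply/measurable_EFinP; apply: measurable_funM.
    exact: measurableT_comp.
  apply: measurable_funM.
    by apply: (measurableT_comp mg); exact: measurableT_comp.
  by apply: (measurableT_comp mk); exact: measurableT_comp.
- by move=> x; rewrite lee_fin expR_ge0.
- move=> [w [u tau]]; rewrite lee_fin /h1 /h2/=.
  have [uE|uE] := boolP (u \in E).
    have := load_next w tau (card_neq0 Id) (fun i => bE u i (set_mem uE)).
    move=> /le_trans; apply.
    rewrite ler_wpM2l ?expR_ge0// ler_wpM2r ?expR_ge0//.
    by rewrite /g indicE uE mulr1 opprB addrC subrK mulNr mulVf ?gt_eqF.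
  have := load_next w tau (card_neq0 Id) (fun i _ => time_ge0 j i u).
  move=> /le_trans; apply; rewrite ler_wpM2l ?expR_ge0// ler_wpM2r ?expR_ge0//.
  by rewrite /g indicE (negbTE uE) !mulr0 subr0 expR0.
Qed.

Let sum_weight : \sum_(j < M) \sum_(I : {set 'I_N} | #|I| == d) p j * q I = 1.
Proof.
rewrite -p_sum; apply: eq_bigr => j _.
by rewrite -mulr_sumr policy_q.2 mulr1.
Qed.

Let F_ge0 : (0 <= F)%E.
Proof. by apply: integral_ge0 => w _; rewrite lee_fin expR_ge0. Qed.

Let F_fin : F \is a fin_num.
Proof.
rewrite ge0_fin_numE// (@le_lt_trans _ _ 1%E) ?ltry// FE.
rewrite -[leRHS]/(1%:E) -sum_weight -sumEFin; apply: lee_sum => j _.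
rewrite -sumEFin; apply: lee_sum => I /eqP Id.
rewrite -[leRHS]mule1 lee_wpmul2l// lee_fin mulr_ge0//.
exact: policy_q.1.
Qed.

Let F_gt0 : (0 < F)%E.
Proof.
rewrite lt_neqAle F_ge0 andbT; apply/negP => /eqP F0.
have load_ge0 w : 0 <= load w by exact: expR_ge0.
have /ae_eq_integral_abs : measurable_fun setT (fun w => (load w)%:E).
  exact/measurable_EFinP.
move=> /(_ pi measurableT)[+ _].
rewrite (eq_integral (fun w => (load w)%:E)); last first.
  by move=> w _; rewrite gee0_abs// lee_fin.
move=> /(_ (esym F0))[A [mA A0 sA]].
have AT : A = setT.
  apply/seteqP; split=> // w _; apply: sA => /(_ I)/eqP.
  by rewrite eqe gt_eqF// expR_gt0.
have /eqP : (1 = 0 :> \bar R)%E by rewrite -(probability_setT pi) -A0 AT.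
by rewrite onee_eq0.
Qed.

Let L_ge0 : 0 <= L.
Proof. by rewrite divr_ge0 ?ltW// subr_gt0. Qed.

Let F_contraction : (F <= F * ((1 - (1 - theta) * eta) * L)%:E)%E.
Proof.
have JI (I : {set 'I_N}) : #|I| = d -> (\sum_(j < M) (p j * q I)%:E * J j I <=
    (q I)%:E * (F * ((1 - (1 - theta) * eta) * L)%:E))%E.
  move=> Id; have [j0 [E [mE bE etaE]]] := slow Id.
  have qI0 := policy_q.1 I Id.
  (* For a given [I] only the type supplied by [slow] brings a gain; for the others [J_le] is
     applied with the empty event. *)
  pose a j := if j == j0 then fine (P E) else 0.
  have J_lea j : (J j I <= (fine F * ((1 - (1 - theta) * a j) * L))%:E)%E.
    rewrite EFinM fineK// EFinM EFinB EFinM /a.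
    have [->|_] := eqVneq j j0.
      by rewrite fineK ?fin_num_measure//; exact: J_le.
    have := @J_le j I set0 Id measurable0 (fun _ _ => False_ind _).
    by rewrite measure0.
  have etaE' : eta <= p j0 * a j0.
    by rewrite -lee_fin EFinM /a eqxx fineK ?fin_num_measure.
  apply: (@le_trans _ _ (\sum_(j < M)
      (p j * q I * (fine F * ((1 - (1 - theta) * a j) * L)))%:E)%E).
    apply: lee_sum => j _; rewrite [leRHS]EFinM lee_wpmul2l//.
    by rewrite lee_fin mulr_ge0.
  rewrite sumEFin -[F in leRHS]fineK// -!EFinM lee_fin.
  rewrite (_ : \sum_(j < M) _ =
      q I * (fine F * ((1 - (1 - theta) * (p j0 * a j0)) * L))).
    rewrite ler_wpM2l// ler_wpM2l ?fine_ge0// ler_wpM2r// lerD2l lerN2.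
    by rewrite ler_wpM2l// subr_ge0 ltW.
  have aE : \sum_(j < M) p j * a j = p j0 * a j0.
    rewrite (bigD1 j0)//= big1 ?addr0// => j /negbTE jj0.
    by rewrite /a jj0 mulr0.
  rewrite -aE -[X in _ = _ * (_ * ((X - _) * _))]p_sum.
  rewrite mulr_sumr -sumrB mulr_suml mulr_sumr mulr_sumr.
  by apply: eq_bigr => j _; ring.
rewrite {1}FE exchange_big/=.
apply: (@le_trans _ _ (\sum_(I : {set 'I_N} | #|I| == d)
    (q I)%:E * (F * ((1 - (1 - theta) * eta) * L)%:E))%E).
  by apply: lee_sum => I /eqP; exact: JI.
rewrite -[F in leLHS]fineK// -EFinM.
under eq_bigr do rewrite -EFinM.
rewrite sumEFin -mulr_suml policy_q.2 mul1r EFinM fineK//.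
Qed.

Lemma stationary_rate_le : lambda * (eta * (1 - expR (- 1))) <= N%:R / beta.
Proof.
have ls : 0 < lambda - s * N%:R by rewrite subr_gt0.
have : 1 <= (1 - (1 - theta) * eta) * L.
  have := F_contraction; rewrite -[F]fineK// -EFinM lee_fin.
  by rewrite -[leLHS]mulr1 ler_pM2l// fine_gt0// F_gt0 ltey_eq F_fin.
rewrite /L => h; rewrite mulrA ler_pdivlMr// in h.
rewrite -/theta [leRHS]mulrC -/s; nra.
Qed.

End instability.

(** * Tails and products of independent random variables *)

Section random_variables.
Context {R : realType} {dT : measure_display} {T : measurableType dT}.
Variable P : probability T R.
Implicit Types X Y Z : {RV P >-> R}.
Local Open Scope ereal_scope.

(** Otherwise [Z] is below every a > 0 almost surely, and its mean is at most 0. *)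
Lemma expectation_gt0_tail Z : (forall u, 0 <= Z u)%R -> 0 < 'E_P[Z] ->
  exists2 a : R, (0 < a)%R & 0 < P [set u | a <= Z u]%R.
Proof.
move=> Z0 EZ; apply: contrapT => noa.
have EZle (a : R) : (0 < a)%R -> 'E_P[Z] <= a%:E.
  move=> a0; have Pa0 : P [set u | a <= Z u]%R = 0.
    apply/eqP; rewrite eq_le measure_ge0 andbT leNgt; apply/negP => Pa.
    by apply: noa; exists a.
  have -> : a%:E = \int[P]_u (cst a%:E u).
    by rewrite integral_cst//= probability_setT mule1.
  rewrite unlock; apply: ae_ge0_le_integral => //.
  - by move=> u _; rewrite lee_fin.
  - exact/measurable_EFinP.
  - by move=> u _; rewrite lee_fin ltW.
  - exists [set u | a <= Z u]%R; split => //.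
      by rewrite -[X in measurable X]setTI; apply: measurable_fun_le.
    move=> u /= nZa; rewrite leNgt; apply/negP => Za; apply: nZa => _.
    by rewrite lee_fin ltW.
have : 'E_P[Z] <= 0.
  apply/lee_addgt0Pr => a a0; rewrite add0e; exact: EZle.
by rewrite leNgt EZ.
Qed.

(** Independence says that the joint law and the product of the marginals agree on rectangles, hence
    everywhere; Tonelli then splits the integral. *)
Lemma ge0_integral_mul_independent X Y :
  (forall u, 0 <= X u)%R -> (forall u, 0 <= Y u)%R ->
  (forall A B, measurable A -> measurable B ->
    P (X @^-1` A `&` Y @^-1` B) = P (X @^-1` A) * P (Y @^-1` B)) ->
  \int[P]_u (X u * Y u)%:E = \int[P]_u (X u)%:E * \int[P]_u (Y u)%:E.
Proof.
move=> X0 Y0 XY.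
pose XYpair (u : T) : R * R := (X u, Y u).
have mXY : measurable_fun setT XYpair by exact/measurable_fun_pair.
pose PG : giry T R := (P : subprobability T R).
pose mu1 : probability R R := distribution P X.
pose mu2 : probability R R := distribution P Y.
(* Absolute values make the integrand nonnegative on the whole plane and change nothing at the
   values of [X] and [Y]. *)
have mf : measurable_fun setT (fun x : R => (`|x|%R)%:E).
  by apply/measurable_EFinP; exact: normr_measurable.
have mff : measurable_fun setT (fun x : R * R => (`|x.1| * `|x.2|)%R%:E).
  apply/measurable_EFinP; apply: measurable_funM; exact: measurableT_comp.
have lawE C : measurable C -> (mu1 \x mu2) C = giry_map mXY PG C.
  apply: (@product_measure_unique _ _ _ _ _ mu1 mu2 (giry_map mXY PG)).
  by move=> A B mA mB; rewrite -XY.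
transitivity (\int[giry_map mXY PG]_x (`|x.1| * `|x.2|)%R%:E).
  rewrite [RHS]giry_int_map//.
  by apply: eq_integral => u _ /=; rewrite !ger0_norm.
transitivity (\int[mu1 \x mu2]_x (`|x.1| * `|x.2|)%R%:E).
  by apply: eq_measure_integral => C mC _; exact/esym/lawE.
rewrite fubini_tonelli1//=.
have E2 : \int[mu2]_y (`|y|)%R%:E = \int[P]_u (Y u)%:E.
  rewrite ge0_integral_distribution//.
  by apply: eq_integral => u _ /=; rewrite ger0_norm.
have E1 : \int[mu1]_y (`|y|)%R%:E = \int[P]_u (X u)%:E.
  rewrite ge0_integral_distribution//.
  by apply: eq_integral => u _ /=; rewrite ger0_norm.
rewrite -E1 -E2 -ge0_integralZr//; last first.
  by apply: integral_ge0 => y _; rewrite lee_fin.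
apply: eq_integral => x _; rewrite /fubini_F/=.
under eq_integral do rewrite EFinM.
by rewrite ge0_integralZl// lee_fin.
Qed.

Lemma mutually_independent_pair (K : finType) (Z : K -> {RV P >-> R}) k l :
  mutually_independent Z -> k != l ->
  forall A B, measurable A -> measurable B ->
    P (Z k @^-1` A `&` Z l @^-1` B) = P (Z k @^-1` A) * P (Z l @^-1` B).
Proof.
move=> indZ kl A B mA mB.
have := indZ [set k; l]%SET (fun m => if m == k then A else B).
rewrite big_setU1 ?inE//= big_set1 eqxx eq_sym (negbTE kl) => <-; last first.
  by move=> m; case: ifP.
congr (P _); apply/seteqP; split => u /=.
  move=> [Au Bu] m /=; rewrite !inE => /orP[] /eqP ->; first by rewrite eqxx.
  by rewrite eq_sym (negbTE kl).
move=> h; split.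
  by have := h k; rewrite /= !inE eqxx => /(_ isT).
by have := h l; rewrite /= !inE eqxx orbT eq_sym (negbTE kl) => /(_ isT).
Qed.

Lemma mutually_independent_tails (K : finType) (Z : K -> {RV P >-> R}) (a : R) :
  mutually_independent Z -> (forall k, 0 < P [set u | a <= Z k u]%R) ->
  0 < P [set u | forall k, a <= Z k u]%R.
Proof.
move=> indZ Za.
have -> : [set u | forall k, a <= Z k u]%R =
    \bigcap_(k in [set k | k \in [set: K]%SET]) (Z k @^-1` `[a, +oo[).
  apply/seteqP; split => u /=.
    by move=> h k _; rewrite /= in_itv/= andbT.
  by move=> h k; have := h k; rewrite /= in_itv/= andbT; apply; rewrite inE.
rewrite indZ; last by move=> k; exact: measurable_itv.
apply: (big_ind (fun x => 0 < x)) => //; first exact: mule_gt0.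
move=> k _; rewrite (_ : _ @^-1` _ = [set u | a <= Z k u]%R)//.
by apply/seteqP; split => u /=; rewrite in_itv/= andbT.
Qed.

End random_variables.

(** * Stability of full replication *)

Section full_replication.
Context {R : realType} (N M : nat).
Context {dT : measure_display} {T : measurableType dT} (P : probability T R).
Variables (X : 'I_M -> {RV P >-> R}) (Y : 'I_N -> 'I_M -> {RV P >-> R}).
Variables (p : 'I_M -> R) (r : 'I_N -> 'I_M -> R) (lambda eps : R).
Hypotheses (p_ge0 : forall j, 0 <= p j) (p_sum : \sum_(j < M) p j = 1).
Hypothesis time_ge0 : forall j i u, 0 <= processing_time X Y r j i u.
Hypotheses (lambda_gt0 : 0 < lambda) (eps_gt0 : 0 < eps).
Variable full : {set 'I_N}.
Hypotheses (full0 : full != finset.set0) (fullT : forall i, i \in full).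

Let B j u :=
  completion_time (fun=> 0) (fun i => processing_time X Y r j i u) full.

Hypothesis load_lt1 :
  (\sum_(j < M) (p j)%:E * \int[P]_u (B j u)%:E + eps%:E <= (lambda^-1)%:E)%E.

Let B_ge0 j u : 0 <= B j u.
Proof. exact: completion_time_ge0. Qed.

Let mB j : measurable_fun setT (B j).
Proof.
apply: measurable_completion_time => // i; exact: measurable_processing_time.
Qed.

Let diff j (x : T * R) : R := B j x.1 - x.2.

Let mdiff j : measurable_fun setT (diff j).
Proof.
by apply: measurable_funB => //; apply: measurableT_comp (mB j) measurable_fst.
Qed.

Let cst_tuple (x : R) : N.-tuple R := [tuple x | _ < N].

Let measurable_cst_tuple : measurable_fun setT cst_tuple.
Proof.
apply/measurable_fun_tnthP => i.
rewrite (_ : _ \o _ = idfun); first exact: measurable_id.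
by apply/funext => x /=; rewrite tnth_mktuple.
Qed.

HB.instance Definition _ :=
  isMeasurableFun.Build _ _ R (N.-tuple R) cst_tuple measurable_cst_tuple.

Let q (I : {set 'I_N}) : R := (I == full)%:R.

Let card_full (I : {set 'I_N}) : (#|I| == N) = (I == full).
Proof.
have fT : full = finset.setT by apply/setP => i; rewrite fullT finset.inE.
apply/eqP/eqP => [IN|->]; last by rewrite fT cardsT card_ord.
by apply/eqP; rewrite eqEcard fT finset.subsetT cardsT card_ord IN leqnn.
Qed.

Lemma full_static_policy : static_policy N q.
Proof.
split; first by move=> I _; exact: ler0n.
by rewrite (eq_bigl _ _ card_full) big_pred1_eq /q eqxx.
Qed.

Local Open Scope ereal_scope.

(** [K] is the law of the Lindley increment: service requirement of a job of random type minus
    interarrival time. *)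
Let increment_law (e : probability R R) : exists K : probability R R,
  (forall A, measurable A -> K A =
    \sum_(j < M) (p j)%:E * \int[P]_u e [set tau | A (B j u - tau)%R]) /\
  (forall f, measurable_fun setT f -> (forall x, 0 <= f x) ->
    \int[K]_z f z =
    \sum_(j < M) (p j)%:E * \int[P]_u \int[e]_tau f (B j u - tau)%R).
Proof.
pose PG : giry T R := (P : subprobability T R).
pose eG : giry R R := (e : subprobability R R).
pose m j : giry R R := giry_map (mdiff j) (giry_prod (PG, eG)).
have mE j A : m j A = \int[P]_u e [set tau | A (B j u - tau)%R].
  rewrite /= /pushforward /product_measure1/=; apply: eq_integral => u _.
  by congr (e _); rewrite xsectionE.
have [mu [muE mu_int]] :=
  finite_mixtureP (fun j => m j : {measure set _ -> \bar R}) p_ge0.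
have mu1 : mu setT = 1.
  rewrite muE -[RHS]/(1%:E) -p_sum -sumEFin; apply: eq_bigr => j _.
  rewrite -[RHS]mule1; congr (_ * _); apply: (etrans (mE j setT)).
  rewrite (eq_integral (cst 1)).
    by rewrite integral_cst//= probability_setT mule1.
  by move=> u _; exact: probability_setT.
(* [mu] already has mass 1; normalising only makes it a probability, with [e] as default value. *)
exists (mnormalize mu e).
have KE A : mnormalize mu e A = mu A.
  by rewrite /mnormalize mu1 onee_eq0/= invr1 mule1.
split=> [A mA|f mf f0].
  transitivity (mu A); first exact: KE.
  by rewrite muE; apply: eq_bigr => j _; congr (_ * _); exact: mE.
transitivity (\int[mu]_x f x).
  by apply: eq_measure_integral => A mA _; exact: KE.
rewrite mu_int//; apply: eq_bigr => j _; congr (_ * _).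
exact: (ge0_integral_pushforward_prod P e (mdiff j)).
Qed.

Lemma full_replication_stable : stable X Y p r lambda N q.
Proof.
right; split=> //.
have [e eE] := exponential_prob_probability lambda_gt0.
have [K [KE K_int]] := increment_law e.
have li0 : (0 < lambda^-1)%R by rewrite invr_gt0.
have [w|nu nuE] := lindley_stationary li0 eps_gt0 (K := K).
  have mlump : measurable_fun setT (fun z : R =>
      (if 0 < w + z then w + z + lambda^-1 else 0)%R%:E).
    apply/measurable_EFinP; apply: measurable_fun_if => //.
    - by apply: measurable_fun_ltr => //; exact: measurable_funD.
    - apply: measurable_funTS.
      by apply: measurable_funD => //; exact: measurable_funD.
  rewrite K_int//; last first.
    move=> z; rewrite lee_fin; case: ifPn => // wz.
    by rewrite addr_ge0 ?ltW.
  apply: (@le_trans _ _ (\sum_(j < M) (p j)%:E *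
      ((Num.max w 0)%:E + \int[P]_u (B j u)%:E) + eps%:E)).
    rewrite leeD2r//; apply: lee_sum => j _; rewrite lee_wpmul2l ?lee_fin//.
    have -> : (Num.max w 0)%:E = \int[P]_u (cst (Num.max w 0)%:E u).
      by rewrite integral_cst//= probability_setT mule1.
    rewrite -ge0_integralD//; last 3 first.
    + by move=> u _; rewrite lee_fin le_max lexx orbT.
    + by move=> u _; rewrite lee_fin.
    + exact/measurable_EFinP.
    have mwd : measurable_fun setT (fun x : T * R =>
      (if 0 < w + diff j x then w + diff j x + lambda^-1 else 0)%R%:E).
      exact: (measurableT_comp mlump (mdiff j)).
    apply: ge0_le_integral => //.
    + move=> u _; apply: integral_ge0 => tau _; rewrite lee_fin.
      by case: ifPn => // wz; rewrite addr_ge0 ?ltW.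
    + apply: (@measurable_fun_fubini_tonelli_F _ _ _ _ _ e (fun x : T * R =>
        (if 0 < w + diff j x then w + diff j x + lambda^-1 else 0)%R%:E)) => //.
      move=> x.
      by rewrite lee_fin; case: ifPn => // wz; rewrite addr_ge0 ?ltW.
    + by apply: emeasurable_funD => //; exact/measurable_EFinP.
    + move=> u _ /=.
      (* The overshoot bound is used at c = w + B. Since B >= 0, max (w + B) 0 <= max w 0 + B, and
         [load_lt1] then pays for the mean of B and for [eps]. *)
      apply: le_trans (_ : _ <= (Num.max (w + B j u) 0)%:E) _.
        apply: le_trans (integral_exponential_prob_overshoot lambda_gt0 eE _).
        rewrite le_eqVlt; apply/orP; left; apply/eqP.
        by apply: eq_integral => tau _; rewrite /diff/= addrA.
      rewrite -EFinD lee_fin ge_max lerD2r le_max lexx/=.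
      by rewrite addr_ge0// le_max lexx orbT.
  under eq_bigr do rewrite muleDr//.
  rewrite big_split/= -ge0_sume_distrl//; last by move=> j _; rewrite lee_fin.
  rewrite sumEFin p_sum mul1e -addeA EFinD leeD2l//.
(* The stationary law of the Lindley recursion, carried to the diagonal. *)
exists (distribution nu cst_tuple) => A mA.
rewrite ge0_integral_distribution//; last 2 first.
- exact: (measurable_workload_transition X Y p r N q eE mA).
- move=> w; apply: workload_transition_ge0 => //; last exact: eE.
  exact: full_static_policy.
have mA' : measurable (cst_tuple @^-1` A).
  by rewrite -[X in measurable X]setTI; exact: measurable_cst_tuple.
apply: (etrans (nuE _ mA')); apply: eq_integral => w _ /=.
have mB' : measurable [set z | (cst_tuple @^-1` A) (Num.max 0 (w + z))%R].
  have : measurable_fun setT (fun z => Num.max 0 (w + z))%R.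
    by apply: measurable_maxr => //; exact: measurable_funD.
  by move/(_ measurableT _ mA'); rewrite setTI.
apply: (etrans (KE _ mB')).
rewrite /workload_transition -eE; apply: eq_bigr => j _.
rewrite (eq_bigl _ _ card_full) big_pred1_eq /q eqxx mulr1; congr (_ * _).
apply: eq_integral => u _; congr (e _); apply/seteqP; split => tau /=;
  by rewrite next_workload_cst.
Qed.

End full_replication.

(** * Stability regions *)

Section almost_everywhere.
Context {R : realType} (N M : nat).
Context {dT : measure_display} {T : measurableType dT} (P : probability T R).
Variables (X : 'I_M -> {RV P >-> R}) (p : 'I_M -> R) (r : 'I_N -> 'I_M -> R).
Implicit Types Y : 'I_N -> 'I_M -> {RV P >-> R}.

(** The chain sees the speed variations only through integrals over [P]. *)
Lemma workload_transition_ae Y Y' (lambda : R) d q (w : N.-tuple R) A :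
  (forall i j, {ae P, forall u, Y i j u = Y' i j u}) ->
  0 < lambda -> measurable A ->
  workload_transition X Y p r lambda d q w A =
  workload_transition X Y' p r lambda d q w A.
Proof.
move=> YY' lambda_gt0 mA.
have [e eE] := exponential_prob_probability lambda_gt0.
have msec (Z : 'I_N -> 'I_M -> {RV P >-> R}) j I :
    measurable_fun setT (fun u =>
      e [set tau |
        A (next_workload w (fun i => processing_time X Z r j i u) I tau)]).
  pose next (x : T * R) :=
    next_workload w (fun i => processing_time X Z r j i x.1) I x.2.
  have mnext : measurable_fun setT next.
    apply: measurable_next_workload => // i.
    by apply: (measurableT_comp (measurable_processing_time X Z r j i)).
  have mB : measurable (next @^-1` A).
    by rewrite -[X in measurable X]setTI; exact: mnext.
  have := measurable_fun_xsection e mB; congr measurable_fun.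
  by apply/funext => u /=; congr (e _); rewrite xsectionE.
rewrite /workload_transition -eE; apply: eq_bigr => j _; apply: eq_bigr => I _.
congr (_ * _)%E; apply: ae_eq_integral => //.
have : {ae P, forall u, forall i, Y i j u = Y' i j u}.
  by apply: filter_forall => i; exact: YY'.
apply: filterS => u Yu _; congr (e _).
rewrite (_ : (fun i => processing_time X Y r j i u) =
  (fun i => processing_time X Y' r j i u))//.
by apply/funext => i; rewrite /processing_time Yu.
Qed.

Lemma stability_region_ae Y Y' d :
  (forall i j, {ae P, forall u, Y i j u = Y' i j u}) ->
  stability_region X Y p r d = stability_region X Y' p r d.
Proof.
suff sub (Z Z' : 'I_N -> 'I_M -> {RV P >-> R}) :
    (forall i j, {ae P, forall u, Z i j u = Z' i j u}) ->
    stability_region X Z p r d `<=` stability_region X Z' p r d.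
  move=> YY'; apply/seteqP; split; apply: sub => // i j.
  by have := YY' i j; apply: filterS => u ->.
move=> ZZ' lambda [lambda_ge0 [q policy_q stq]]; split; first exact: lambda_ge0.
exists q; first exact: policy_q.
case: stq => [->|[lambda_gt0 [pi inv]]]; [by left|right].
split; first exact: lambda_gt0.
exists pi => A mA; apply: (etrans (inv A mA)); apply: eq_integral => w _.
exact: workload_transition_ae ZZ' lambda_gt0 mA.
Qed.

End almost_everywhere.

Section stability_regions.
Context {R : realType} (N M : nat).
Context {dT : measure_display} {T : measurableType dT} (P : probability T R).
Variables (X : 'I_M -> {RV P >-> R}) (Y : 'I_N -> 'I_M -> {RV P >-> R}).
Variables (p : 'I_M -> R) (r : 'I_N -> 'I_M -> R).
Hypotheses (p_ge0 : forall j, 0 <= p j) (p_sum : \sum_(j < M) p j = 1).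
Hypothesis time_ge0 : forall j i u, 0 <= processing_time X Y r j i u.

Lemma stability_region_le (d : nat) (beta eta lambda : R) :
  (0 < d)%N -> 0 < beta -> 0 <= eta <= 1 ->
  (forall I : {set 'I_N}, #|I| = d ->
    exists (j : 'I_M) (E : set T), [/\ measurable E,
      forall u i, E u -> i \in I -> beta <= processing_time X Y r j i u &
      (eta%:E <= (p j)%:E * P E)%E]) ->
  stability_region X Y p r d lambda ->
  lambda * (eta * (1 - expR (- 1))) <= N%:R / beta.
Proof.
move=> d_gt0 beta_gt0 /andP[eta_ge0 eta_le1] slow.
move=> [lambda_ge0 [q policy_q [->|[lambda_gt0 [pi inv]]]]].
  by rewrite mul0r divr_ge0// ltW.
have [lambda_le|lambda_gt] := leP lambda (beta^-1 * N%:R).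
  rewrite [leRHS]mulrC; apply: le_trans lambda_le; apply: ler_piMr => //.
  have theta_ge0 : 0 <= 1 - expR (- 1) :> R by rewrite subr_ge0 expR_le1 lerN10.
  apply: mulr_ile1 => //; rewrite lerBlDr lerDl; exact: expR_ge0.
have [e eE] := exponential_prob_probability lambda_gt0.
exact: (stationary_rate_le p_ge0 p_sum d_gt0 policy_q time_ge0 beta_gt0 slow
  lambda_gt eE inv).
Qed.

Lemma full_stability_region (mean lambda : R) : (0 < N)%N ->
  (\sum_(j < M) (p j)%:E *
     \int[P]_u (completion_time (fun=> 0)
       (fun i => processing_time X Y r j i u) (finset.setT : {set 'I_N}))%:E <=
   mean%:E)%E ->
  0 <= lambda -> lambda * mean < 1 -> stability_region X Y p r N lambda.
Proof.
move=> N_gt0 meanE lambda_ge0 lambda_mean; split; first exact: lambda_ge0.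
have fT i : i \in (finset.setT : {set 'I_N}) by rewrite finset.inE.
have f0 : (finset.setT : {set 'I_N}) != finset.set0.
  by apply/set0Pn; exists (Ordinal N_gt0).
exists (fun I => (I == finset.setT)%:R); first exact: full_static_policy.
move: lambda_ge0; rewrite le_eqVlt => /predU1P[<-|lambda_gt0]; first by left.
apply: (full_replication_stable (eps := lambda^-1 - mean)) => //.
  by rewrite subr_gt0 -[ltRHS]mul1r ltr_pdivlMr// mulrC.
apply: (@le_trans _ _ (mean%:E + (lambda^-1 - mean)%:E)%E).
  by rewrite leeD2r.
by rewrite -EFinD addrC subrK.
Qed.

End stability_regions.

(** * Speed variations made nonnegative everywhere *)

Section positive_part.
Context {R : realType} {dT : measure_display} {T : measurableType dT}.
Variables (P : probability T R) (Y S : {RV P >-> R}).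
Hypothesis Y_law : forall A, measurable A ->
  distribution P Y A = distribution P S A.
Hypothesis S_ge0 : forall u, 0 <= S u.

(** [Y] has the law of a nonnegative variable but may be negative on a null set, whereas the bounds
    on processing times are pointwise. *)
Definition positive_part : {RV P >-> R} := max_mfun Y (cst 0).

Lemma positive_part_ge0 u : 0 <= positive_part u.
Proof. by rewrite le_max lexx orbT. Qed.

Lemma positive_part_ae : {ae P, forall u, Y u = positive_part u}.
Proof.
exists (Y @^-1` `]-oo, 0[); split.
- by rewrite -[X in measurable X]setTI; exact: measurable_funP.
- apply: (etrans (Y_law (measurable_itv `]-oo, 0[))).
  rewrite /distribution /pushforward (_ : _ @^-1` _ = set0) ?measure0//.
  by apply/seteqP; split => u //=; rewrite in_itv/= ltNge S_ge0.
- move=> u /= Yu; rewrite in_itv/= ltNge; apply/negP => Y0; apply: Yu.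
  by rewrite /positive_part/= (max_idPl Y0).
Qed.

Lemma positive_part_tail (a : R) : 0 < a ->
  P [set u | a <= positive_part u] = P [set u | a <= S u].
Proof.
move=> a0.
have := Y_law (measurable_itv `[a, +oo[).
rewrite /distribution /pushforward => E.
transitivity (P (Y @^-1` `[a, +oo[)).
  congr (P _); apply/seteqP; split => u /=; rewrite in_itv/= andbT le_max.
    by case/orP => //; rewrite leNgt a0.
  by move=> ->.
apply: (etrans E); congr (P _).
by apply/seteqP; split => u /=; rewrite in_itv/= andbT.
Qed.

Lemma integral_positive_part :
  (\int[P]_u (positive_part u)%:E = \int[P]_u (S u)%:E)%E.
Proof.
have mmax : measurable_fun setT (fun x : R => (Num.max x 0)%:E).
  by apply/measurable_EFinP; exact: measurable_maxr.
have max0 (x : R) : (0 <= (Num.max x 0)%:E)%E.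
  by rewrite lee_fin le_max lexx orbT.
transitivity (\int[distribution P Y]_x (Num.max x 0)%:E)%E.
  by rewrite ge0_integral_distribution.
transitivity (\int[distribution P S]_x (Num.max x 0)%:E)%E.
  by apply: eq_measure_integral => A mA _; exact: Y_law.
rewrite ge0_integral_distribution//; apply: eq_integral => u _ /=.
by rewrite (max_idPl (S_ge0 u)).
Qed.

End positive_part.

(** * Choice of the constants and comparison of the two regions *)

Theorem theorem4 (R : realType) (N : nat) (hN : (2 <= N)%N)
  (p : 'I_N -> R) (p_gt0 : forall j, 0 < p j) (p_sum : \sum_(j < N) p j = 1)
  (dT : measure_display) (T : measurableType dT) (P : probability T R)
  (X S : 'I_N -> {RV P >-> R}) (Y : 'I_N -> 'I_N -> {RV P >-> R})
  (X_ge0 : forall j u, 0 <= X j u) (S_ge0 : forall j u, 0 <= S j u)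
  (Y_law : forall i j A, measurable A ->
     distribution P (Y i j) A = distribution P (S j) A)
  (XY_indep : forall j, mutually_independent
     (fun k : option 'I_N => if k is Some i then Y i j else X j))
  (X_int : forall j, P.-integrable setT (EFin \o X j))
  (X_mean : forall j, (0 < 'E_P[X j])%E)
  (S_int : forall j, P.-integrable setT (EFin \o S j))
  (S_mean : forall j, (0 < 'E_P[S j])%E)
  (S_NBU : forall j, NBU (S j))
  (rfast : R) (rfast_gt0 : 0 < rfast)
  (d : nat) (hd : (1 <= d < N)%N) :
  exists x0 : R, 0 < x0 /\
    forall rslow : R, 0 < rslow -> rslow / rfast < x0 ->
      stability_region X Y p (fast_slow_speed rfast rslow) d `<`
      stability_region X Y p (fast_slow_speed rfast rslow) N.
Proof.
have [d_gt0 d_lt] := andP hd.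
have p_ge0 j : 0 <= p j by exact: ltW.
pose Yp i j := positive_part (Y i j).
have YYp i j : {ae P, forall u, Y i j u = Yp i j u}.
  exact: positive_part_ae (Y_law i j) (S_ge0 j).
have Yp_ge0 i j u : 0 <= Yp i j u by exact: positive_part_ge0.
pose Z j (k : option 'I_N) := if k is Some i then Yp i j else X j.
have Z_indep j : mutually_independent (Z j).
  move=> J A mA.
  (* Truncation acts on each variable separately, so an event on [Yp] is an event on [Y] for the
     preimage. *)
  pose A' k : set R :=
    if k is Some _ then (fun x => Num.max x 0) @^-1` A k else A k.
  have mA' k : measurable (A' k).
    case: k => [i|]; last exact: mA.
    rewrite -[X in measurable X]setTI.
    have : measurable_fun setT (fun x : R => Num.max x 0).
      exact: measurable_maxr.
    by move/(_ measurableT _ (mA (Some i))).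
  have := XY_indep j J A' mA'.
  rewrite (_ : \bigcap_(k in _) _ =
      \bigcap_(k in [set k | k \in J]) (Z j k @^-1` A k)).
    by move=> ->; apply: eq_bigr => -[i|].
  by apply: eq_bigcapr => -[i|].
have tails j : exists2 a : R, 0 < a &
    (0 < P [set u | forall k, (a <= Z j k u)%R])%E.
  have [a a0 Xa] := expectation_gt0_tail (X_ge0 j) (X_mean j).
  have [b b0 Sb] := expectation_gt0_tail (S_ge0 j) (S_mean j).
  have ab0 : 0 < Num.min a b by rewrite lt_min a0.
  exists (Num.min a b) => //; apply: mutually_independent_tails => // -[i|].
    rewrite (positive_part_tail (Y_law i j))//; apply: (lt_le_trans Sb).
    apply: le_measure; rewrite ?inE.
    - by rewrite -[X in measurable X]setTI; apply: measurable_fun_le.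
    - by rewrite -[X in measurable X]setTI; apply: measurable_fun_le.
    - by move=> u /= bu; rewrite ge_min bu orbT.
  apply: (lt_le_trans Xa); apply: le_measure; rewrite ?inE.
  - by rewrite -[X in measurable X]setTI; apply: measurable_fun_le.
  - by rewrite -[X in measurable X]setTI; apply: measurable_fun_le.
  - by move=> u /= au; rewrite ge_min au.
pose a j : R := s2val (cid2 (tails j)).
have a_gt0 j : 0 < a j by rewrite /a; case: cid2.
pose E j : set T := [set u | forall k, a j <= Z j k u].
have Ea_gt0 j : (0 < P (E j))%E by rewrite /E /a; case: cid2.
have mE j : measurable (E j).
  rewrite (_ : E j = \bigcap_(k in [set` [set: option 'I_N]%SET])
      [set u | a j <= Z j k u]).
    apply: fin_bigcap_measurable => // k _.
    by rewrite -[X in measurable X]setTI; apply: measurable_fun_le.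
  apply/seteqP; split => u /=; first by move=> h k _; exact: h.
  by move=> h k; apply: h; rewrite /= inE.
pose a0 : R := \big[Num.min/1]_j a j.
have a0_gt0 : 0 < a0 by rewrite lt_bigmin.
have a0_le j : a0 <= a j by exact: bigmin_le.
(* The default value 1 of the minimum provides [eta <= 1], which [stability_region_le] requires. *)
pose eta : R := \big[Num.min/1]_j (p j * fine (P (E j))).
have eta_gt0 : 0 < eta.
  apply: lt_bigmin => // j _; rewrite mulr_gt0// fine_gt0//.
  by rewrite Ea_gt0/= ltey_eq fin_num_measure.
have eta_le1 : eta <= 1 by exact: bigmin_le_id.
have eta_le' j : eta <= p j * fine (P (E j)) by exact: bigmin_le.
have eta_le j : (eta%:E <= (p j)%:E * P (E j))%E.
  by rewrite -[P (E j)]fineK ?fin_num_measure// -EFinM lee_fin.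
have theta_gt0 : 0 < 1 - expR (- 1) :> R.
  by rewrite subr_gt0 expR_lt1 ltrN10.
have N_gt0 : (0 < N)%N by exact: ltn_trans hN.
(* On [E j] size and speed variations are at least [a0], so beta = a0 ^ 2 / rslow; the bound on
   lambda then reads C rslow. *)
pose C : R := N%:R / a0 ^+ 2 / (eta * (1 - expR (- 1))).
have C_gt0 : 0 < C by rewrite !divr_gt0 ?exprn_gt0 ?mulr_gt0 ?ltr0n.
have time_ge0 (rslow : R) : 0 < rslow -> forall j i u,
    0 <= processing_time X Yp (fast_slow_speed rfast rslow) j i u.
  move=> rslow_gt0 j i u; rewrite divr_ge0 ?mulr_ge0//.
  by rewrite /fast_slow_speed; case: ifP => _; exact: ltW.
have few_le (rslow lambda : R) : 0 < rslow ->
    stability_region X Yp p (fast_slow_speed rfast rslow) d lambda ->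
    lambda <= C * rslow.
  move=> rslow_gt0 st.
  have beta_gt0 : 0 < a0 ^+ 2 / rslow by rewrite divr_gt0 ?exprn_gt0.
  have eta01 : 0 <= eta <= 1 by rewrite ltW.
  have slow (I : {set 'I_N}) : #|I| = d ->
      exists (j : 'I_N) (F : set T), [/\ measurable F,
      forall u i, F u -> i \in I -> a0 ^+ 2 / rslow <=
        processing_time X Yp (fast_slow_speed rfast rslow) j i u &
      (eta%:E <= (p j)%:E * P F)%E].
    move=> Id; have [j jI] : exists j, j \notin I.
      apply/existsP; rewrite -negb_forall; apply/negP => /forallP IT.
      by move: d_lt; rewrite -Id eq_cardT// -cardT card_ord ltnn.
    exists j, (E j); split=> // u i Eu iI.
    rewrite /processing_time /fast_slow_speed ifF; last first.
      by apply/eqP => ij; move: jI; rewrite -ij iI.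
    rewrite ler_pM2r ?invr_gt0// expr2; apply: ler_pM; rewrite ?(ltW a0_gt0)//.
      exact: le_trans (a0_le j) (Eu None).
    exact: le_trans (a0_le j) (Eu (Some i)).
  have := stability_region_le p_ge0 p_sum (time_ge0 _ rslow_gt0) d_gt0 beta_gt0
    eta01 slow st.
  rewrite -ler_pdivlMr ?mulr_gt0// invf_div => /le_trans; apply.
  rewrite /C mulrA le_eqVlt; apply/orP; left; apply/eqP.
  by rewrite -!mulrA; congr (_ * _); ring.
(* A type-j job completes no later than its replica on the fast server j would if started at once;
   this bound on the mean does not involve [rslow]. *)
pose K : R := \sum_(j < N) p j *
  (fine (\int[P]_u (X j u)%:E) * fine (\int[P]_u (S j u)%:E) / rfast).
have K_ge0 : 0 <= K.
  apply: sumr_ge0 => j _.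
  rewrite mulr_ge0// divr_ge0 ?(ltW rfast_gt0)// mulr_ge0//;
    by rewrite fine_ge0//; apply: integral_ge0 => u _; rewrite lee_fin.
have all_stable (rslow lambda : R) :
    0 < rslow -> 0 <= lambda -> lambda * K < 1 ->
    stability_region X Yp p (fast_slow_speed rfast rslow) N lambda.
  move=> rslow_gt0 lambda_ge0.
  apply: (full_stability_region p_ge0 p_sum (time_ge0 _ rslow_gt0)) => //.
  rewrite /K -sumEFin; apply: lee_sum => j _.
  rewrite EFinM lee_wpmul2l ?lee_fin//.
  have XYp : (\int[P]_u (X j u * Yp j j u)%:E =
      \int[P]_u (X j u)%:E * \int[P]_u (S j u)%:E)%E.
    rewrite ge0_integral_mul_independent//.
      by rewrite (integral_positive_part (Y_law j j)).
    exact: (mutually_independent_pair (Z_indep j) (k := None) (l := Some j)).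
  have -> : ((fine (\int[P]_u (X j u)%:E) * fine (\int[P]_u (S j u)%:E) /
      rfast)%:E = \int[P]_u (X j u * Yp j j u / rfast)%:E)%E.
    rewrite EFinM EFinM.
    rewrite (fineK (integrable_fin_num measurableT (X_int j))).
    rewrite (fineK (integrable_fin_num measurableT (S_int j))).
    rewrite -XYp -ge0_integralZr//.
    - by apply/measurable_EFinP; exact: measurable_funM.
    - by move=> u _; rewrite lee_fin mulr_ge0.
    - by rewrite lee_fin invr_ge0 ltW.
  have T0 : (finset.setT : {set 'I_N}) != finset.set0.
    by apply/set0Pn; exists j; rewrite finset.inE.
  apply: ge0_le_integral => //.
  - move=> u _; rewrite lee_fin; apply: completion_time_ge0 => // i.
    exact: time_ge0.
  - apply/measurable_EFinP; apply: measurable_completion_time => // i.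
    exact: measurable_processing_time.
  - apply/measurable_EFinP; apply: measurable_funM => //.
    exact: measurable_funM.
  - move=> u _; rewrite lee_fin.
    have [i _ [_ /(_ j)]] := completion_timeP (fun=> 0) (fun i =>
      processing_time X Yp (fast_slow_speed rfast rslow) j i u) T0.
    rewrite finset.inE add0r /processing_time /fast_slow_speed eqxx.
    by move=> /(_ isT).
(* [K + 1] can be inverted knowing only [K >= 0]. The threshold below says exactly that C rslow < 1
   / (K + 1). *)
have K1_gt0 : 0 < K + 1 by rewrite ltr_wpDl.
exists ((C * (K + 1) * rfast)^-1); split.
  by rewrite invr_gt0 mulr_gt0// mulr_gt0.
move=> rslow rslow_gt0.
rewrite ltr_pdivrMr// invfM divfK ?gt_eqF// => slow_small.
have Cr : C * rslow < (K + 1)^-1.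
  by rewrite mulrC -ltr_pdivlMr// -invfM mulrC.
have in_full (lambda : R) : 0 <= lambda -> lambda < (K + 1)^-1 ->
    stability_region X Yp p (fast_slow_speed rfast rslow) N lambda.
  move=> lambda_ge0 lambda_lt; apply: all_stable => //.
  apply: (@le_lt_trans _ _ (lambda * (K + 1))).
    by rewrite mulrDr mulr1 lerDl.
  by rewrite -ltr_pdivlMr// mul1r.
rewrite !(stability_region_ae X p (fast_slow_speed rfast rslow) _ YYp).
split=> [lambda st|sub].
  apply: in_full; first by case: st.
  exact: le_lt_trans (few_le _ _ rslow_gt0 st) Cr.
(* Strictness: the midpoint of C rslow and 1 / (K + 1) is a stable rate for N replicas and exceeds
   every stable rate for d. *)
have [lt1 lt2] : C * rslow < (C * rslow + (K + 1)^-1) / 2 /\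
    (C * rslow + (K + 1)^-1) / 2 < (K + 1)^-1 by split; lra.
have Cr0 : 0 <= C * rslow by rewrite mulr_ge0 ?ltW.
have := few_le _ _ rslow_gt0 (sub _ (in_full _ (le_trans Cr0 (ltW lt1)) lt2)).
by rewrite leNgt lt1.
Qed.
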